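(* Let $h,r>0$ with $\frac{h}{r}\le \omega$. For every $c\ge 0$ the functional $\mathcal E_c$ admits at least one minimizer on $X$. Moreover, any minimizer $\rho_c$ of $\mathcal E_c$ on $X$ satisfies: (a) $\rho_c$ is even; (b) $\rho_c$ is strictly convex; (c) $\rho_0<\rho_c<r$ on $(-h,h)$ for every $c>0$; (d) $\rho_c\to r$ uniformly on $[-h,h]$ as $c\to+\infty$ (i.e. for any sequence $c_j\to+\infty$ and any choice of minimizers $\rho_{c_j}$ of $\mathcal E_{c_j}$, $\rho_{c_j}\to r$ uniformly); (e) $\rho_c\in C^2([-h,h])$ and $\rho_c$ satisfies the Euler–Lagrange equation $$(1+(\rho')^2)\big((c+\rho^2)(\rho')^2+\rho^2\big)=\rho\rho''\big(\rho^2(\rho')^2+c(2-(\rho')^2)+\rho^2\big)$$ on $[-h,h]$, together with the first integral $$c\frac{(\rho_c')^2}{\rho_c(1+(\rho_c')^2)^{3/2}}-\frac{\rho_c}{\sqrt{1+(\rho_c')^2}}=-\rho_c(0)\quad\text{on }[-h,h].$$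
   Context: Fix $h,r>0$. Let $X=\{\rho\in W^{1,1}(-h,h):\ \rho>0 \text{ on }[-h,h],\ \rho(-h)=\rho(h)=r\}$ (elements of $W^{1,1}(-h,h)$ are identified with their continuous representatives). For $c\ge 0$, $\mathcal E_c:X\to\mathbb R$ is $$\mathcal E_c(\rho)=\int_{-h}^h\left(\rho\sqrt{1+(\rho')^2}+c\frac{(\rho')^2}{\rho\sqrt{1+(\rho')^2}}\right)dx.$$ Let $\Xi$ be the unique positive solution of $\xi\tanh\frac1\xi+\mathrm{sech}^2\frac1\xi=\xi$, and $\omega=\frac{1}{\Xi\cosh(1/\Xi)}$ (numerically $0.52<\omega<0.53$). Under $h/r\le\omega$, let $\Pi_0>0$ be the largest solution of $r=\Pi\cosh\frac{h}{\Pi}$ and $\rho_0(x)=\Pi_0\cosh\frac{x}{\Pi_0}$ on $[-h,h]$ (the catenary). *)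

(* Defs.v *)
From HB Require Import structures.
From mathcomp Require Import all_boot all_order all_algebra.
From mathcomp Require Import all_classical all_reals all_analysis.
Set Implicit Arguments. Unset Strict Implicit. Unset Printing Implicit Defensive.
Import Order.TTheory GRing.Theory Num.Theory.
Import numFieldNormedType.Exports.
Local Open Scope classical_set_scope.
Local Open Scope ring_scope.

Section Defs.
Variable R : realType.

Definition coshR (x : R) : R := (expR x + expR (- x)) / 2.
Definition sinhR (x : R) : R := (expR x - expR (- x)) / 2.
Definition tanhR (x : R) : R := sinhR x / coshR x.
Definition sechR (x : R) : R := (coshR x)^-1.

(* Xi : the unique positive solution of  xi tanh(1/xi) + sech^2(1/xi) = xi
   (written as the supremum of the solution set, which is that solution). *)
Definition Xi : R :=
  sup [set xi : R | 0 < xi /\ xi * tanhR xi^-1 + (sechR xi^-1) ^+ 2 = xi].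
Definition omega : R := (Xi * coshR Xi^-1)^-1.

Definition Pi0 (h r : R) : R :=
  sup [set P : R | 0 < P /\ r = P * coshR (h / P)].
Definition rho0 (h r : R) (x : R) : R := Pi0 h r * coshR (x / Pi0 h r).

(* W^{1,1}(-h,h), continuous representatives: rho is the primitive of an
   integrable function on [-h,h] (i.e. absolutely continuous). *)
Definition W11 (h : R) (rho : R -> R) : Prop :=
  exists g : R -> R,
    (@lebesgue_measure R).-integrable `[-h, h] (EFin \o g) /\
    forall x, x \in `[-h, h] ->
      ((rho x)%:E = (rho (- h))%:E +
        \int[(@lebesgue_measure R)]_(t in `[(- h)%R, x]) (g t)%:E)%E.

Definition admissible (h r : R) (rho : R -> R) : Prop :=
  W11 h rho /\ (forall x, x \in `[-h, h] -> 0 < rho x) /\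
  rho (- h) = r /\ rho h = r.

(* E_c ; rho' is the (a.e. existing) classical derivative. *)
Definition Ec (h c : R) (rho : R -> R) : \bar R :=
  (\int[(@lebesgue_measure R)]_(x in `[(- h)%R, h])
    (let d := derive1 rho x in
     rho x * Num.sqrt (1 + d ^+ 2)
     + c * (d ^+ 2 / (rho x * Num.sqrt (1 + d ^+ 2))))%:E)%E.

Definition minimizer (h r c : R) (rho : R -> R) : Prop :=
  admissible h r rho /\
  forall sigma, admissible h r sigma -> (Ec h c rho <= Ec h c sigma)%E.

Definition has_deriv_within (h : R) (f : R -> R) (x d : R) : Prop :=
  (fun y => (f y - f x) / (y - x)) @ within (fun y => y \in `[-h, h]) x^' --> d.

Definition C2_on (h : R) (rho d1 d2 : R -> R) : Prop :=
  {within `[-h, h], continuous d2} /\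
  forall x, x \in `[-h, h] ->
    has_deriv_within h rho x (d1 x) /\ has_deriv_within h d1 x (d2 x).

Definition strictly_convex_on (h : R) (f : R -> R) : Prop :=
  forall x y t, x \in `[-h, h] -> y \in `[-h, h] -> x != y ->
    0 < t < 1 -> f (t * x + (1 - t) * y) < t * f x + (1 - t) * f y.

End Defs.

(* Main.v *)
(* The energy is calibrated by its first integral.  For m > 0 let y = height p be the
   value at which the constant of motion L - p L_p of the Lagrangian L(y, p) equals m;
   there L(y, z) - m - z L_p(y, p) is an explicit sum of nonnegative terms vanishing
   only at z = p, although L is not convex in p when c > y^2.  Hence an admissible rho
   with minimum m has energy at least Phi(m) = 2 h m + 2 A_m(r), where A_m' = L_p
   is the calibrating slope field, with equality only if |rho'| is almost everywhere the
   field slope.  This reduces the problem to minimizing Phi on (0, r].  A minimum point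
   of Phi is stationary, which says that the extremal with minimum m climbs to the
   height r in time exactly h; so the minimizers are exactly extremals x |-> height (Z
   x) with Z the inverse of the smooth odd function p |-> x, and evenness, convexity,
   regularity and the Euler-Lagrange equation are read off.  For c > 0 a minimum of Phi
   exists because climbing away from a small height takes a logarithmically long time;
   for c = 0 it is the catenary, and h / r <= omega is exactly what makes it beat the
   limit Phi(0+) = r^2.  For (c), comparing the energies of rho_c, the catenary and the
   constant r bounds the minimum of rho_c from below by h, and then the first integral
   gives rho_c >= m sqrt (1 + rho_c'^2), so rho_c grows more slowly than a catenary.
   For (d), 2 sqrt c |rho'| is a lower bound of the energy density, whereas the constant
   r has energy 2 h r. *)
Require Import Defs.
From HB Require Import structures.
From mathcomp Require Import all_boot all_order all_algebra.
From mathcomp Require Import all_classical all_reals all_analysis.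
From mathcomp Require Import measurable_realfun ring lra.
Set Implicit Arguments.
Unset Strict Implicit.
Unset Printing Implicit Defensive.
Import Order.TTheory GRing.Theory Num.Theory.
Import numFieldNormedType.Exports.
Local Open Scope classical_set_scope.
Local Open Scope ring_scope.

(** * Absolutely continuous functions and their densities *)

(** Formally Phi'(m) = 2 (h - T), where T is the time in which the extremal with minimum m climbs
    from m to r. The action is nevertheless never differentiated in m: running the field of one
    minimum along the extremal of another bounds the difference quotients of Phi from both sides,
    and this is enough both for stationarity and for continuity. The main obstacle is the turning
    point. As a function of height, the slope behaves like sqrt (y - m) near y = m, so it is not
    differentiable there, the climbing time is an improper integral, and rho' = slope (rho) has
    solutions that rest at m for a while. Hence everything is parametrized by the slope p, in which
    height, position and action are smooth, and uniqueness comes from counting time rather than from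
    a Lipschitz condition. The numerical constants come from ln 2: it bounds the parameter t0 of the
    catenary, cosh (ln 2) = 5/4 is exact, and 5/8 <= ln 2 <= 18/25 is precise enough. *)

Section NonMeasurable.
Context d (T : measurableType d) (R : realType)
  (mu : {measure set T -> \bar R}).
Local Open Scope ereal_scope.
Import HBNNSimple.

Lemma ge0_le_integral_nonmeasurable (D : set T) (f1 f2 : T -> \bar R) :
  (forall x, D x -> 0 <= f1 x) -> (forall x, D x -> f1 x <= f2 x) ->
  \int[mu]_(x in D) f1 x <= \int[mu]_(x in D) f2 x.
Proof.
move=> f0 f12.
rewrite !ge0_integralE//; last by move=> x Dx; exact: le_trans (f0 x Dx) (f12 x Dx).
apply: ereal_sup_le => _ [k /= hk <-]; exists k => //= x.
apply: le_trans (hk x) _; rewrite !patchE; case: ifPn => // /set_mem; exact: f12.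
Qed.

(* The integrand f need not be measurable: the integral of a nonnegative function is a
   supremum over simple functions below it. *)
Lemma ge0_ae_eq_integral_nonmeasurable (D N : set T) (f g : T -> \bar R) :
  measurable D -> measurable N -> mu N = 0 -> measurable_fun D g ->
  (forall x, D x -> 0 <= f x) -> (forall x, D x -> 0 <= g x) ->
  (forall x, D x -> ~ N x -> f x = g x) ->
  \int[mu]_(x in D) f x = \int[mu]_(x in D) g x.
Proof.
move=> mD mN N0 mg f0 g0 fg; apply/eqP; rewrite eq_le; apply/andP; split.
(* Null sets are removed only from measurable integrands: each simple function below f is cut off on
   N before it is compared with g. *)
- rewrite [leLHS]integral_mkcond ge0_integralTE; last first.
    by move=> x; rewrite patchE; case: ifPn => // /set_mem; exact: f0.
  apply: ge_ereal_sup => _ [k /= hk <-].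
  rewrite -integralT_nnsfun (ge0_negligible_integral mN)//; last 2 first.
  - exact/measurable_EFinP.
  - by move=> x _; rewrite lee_fin.
  rewrite [leRHS]integral_mkcond [leRHS](ge0_negligible_integral mN)//; last 2 first.
  - by apply/(measurable_restrictT _ _).1.
  - by move=> x _; rewrite patchE; case: ifPn => // /set_mem; exact: g0.
  apply: ge0_le_integral_nonmeasurable => x [_ Nx]; first by rewrite lee_fin.
  apply: le_trans (hk x) _; rewrite !patchE; case: ifPn => // /set_mem Dx.
  by rewrite fg.
- rewrite (ge0_negligible_integral mN)//.
  apply: (@le_trans _ _ (\int[mu]_(x in D `\` N) f x)).
    by apply: ge0_le_integral_nonmeasurable => x [Dx Nx]; rewrite ?fg// g0.
  rewrite integral_mkcond [leRHS]integral_mkcond.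
  apply: ge0_le_integral_nonmeasurable => x _.
    by rewrite patchE; case: ifPn => // /set_mem [? _]; exact: f0.
  rewrite !patchE; case: ifPn => [/set_mem [Dx Nx]|_]; first by rewrite mem_set.
  by case: ifPn => // /set_mem; exact: f0.
Qed.

End NonMeasurable.

Section Density.
Variable R : realType.
Notation mu := (@lebesgue_measure R).
Implicit Types (a b x y : R) (f g rho : R -> R).

Definition itg a b f := mu.-integrable `[a, b] (EFin \o f).

Lemma itgS a b x y f : a <= x -> y <= b -> itg a b f -> itg x y f.
Proof.
move=> ax yb; apply: integrableS => //.
by apply: subset_itv; rewrite bnd_simp.
Qed.

Lemma itg_meas a b f : itg a b f -> measurable_fun `[a, b] f.
Proof. by move=> /measurable_int/measurable_EFinP. Qed.

Lemma continuous_itg a b f : {within `[a, b], continuous f} -> itg a b f.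
Proof. by move=> cf; apply: continuous_compact_integrable => //; exact: segment_compact. Qed.

Lemma itg_cst a b (k : R) : itg a b (fun=> k).
Proof. by apply: continuous_itg; apply: continuous_subspaceT; exact: cst_continuous. Qed.

Lemma itg_norm a b f : itg a b f -> itg a b (fun x => `|f x|).
Proof. exact: integrable_norm. Qed.

Lemma itgD a b f g : itg a b f -> itg a b g -> itg a b (fun x => f x + g x).
Proof. by move=> fi gi; apply: (integrableD _ fi gi); exact: measurable_itv. Qed.

Lemma itgZ a b (k : R) f : itg a b f -> itg a b (fun x => k * f x).
Proof. by move=> fi; apply: (integrableZl _ k fi); exact: measurable_itv. Qed.

Lemma itgB a b f g : itg a b f -> itg a b g -> itg a b (fun x => f x - g x).
Proof. by move=> fi gi; apply: (integrableB _ fi gi); exact: measurable_itv. Qed.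

Lemma le_itg a b f g : measurable_fun `[a, b] f -> itg a b g ->
  (forall x, x \in `[a, b] -> `|f x| <= g x) -> itg a b f.
Proof.
move=> mf ig fg; apply: (le_integrable _ _ _ ig) => //.
  exact/measurable_EFinP.
by move=> x xab /=; rewrite lee_fin (le_trans (fg x xab))// ler_norm.
Qed.

Lemma Rint_cat a x b f : a <= x <= b -> itg a b f ->
  \int[mu]_(t in `[a, b]) f t =
  \int[mu]_(t in `[a, x]) f t + \int[mu]_(t in `[x, b]) f t.
Proof.
move=> /andP[ax xb] fi.
apply/eqP; rewrite addrC -subr_eq; apply/eqP.
rewrite Rintegral_itvB//=; [|by rewrite bnd_simp..].
by rewrite Rintegral_itv_obnd_cbnd//; apply: integrableS fi => //; apply: subset_itv; rewrite bnd_simp.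
Qed.

Lemma Rint_ge0_eq0 a b f : itg a b f -> (forall x, x \in `[a, b] -> 0 <= f x) ->
  \int[mu]_(t in `[a, b]) f t = 0 ->
  {ae mu, forall x, x \in `[a, b] -> f x = 0}.
Proof.
move=> fi f0 I0.
have : (\int[mu]_(x in `[a, b]) `|(EFin \o f) x| = 0)%E.
  rewrite -(_ : (\int[mu]_(x in `[a, b]) (f x)%:E) = 0)%E.
    by apply: eq_integral => x /set_mem xab /=; rewrite ger0_norm// f0.
  rewrite -[LHS]fineK; last exact: integrable_fin_num.
  by move: I0; rewrite /Rintegral => ->.
move/ae_eq_integral_abs => [//||N [mN N0 sN]]; first exact: measurable_int fi.
exists N; split => // x /= nx; apply: sN => /= nx'; apply: nx => xab.
by have [] := nx' xab.
Qed.

(** [W11] on a general interval, real-valued and with the derivative named, so that it restricts to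
    subintervals and g can replace [derive1 rho] in the energy. *)
Definition density a b rho g := itg a b g /\
  forall x, x \in `[a, b] -> rho x = rho a + \int[mu]_(t in `[a, x]) g t.

Lemma W11_density h rho : W11 h rho -> exists g, density (- h) h rho g.
Proof.
move=> [g [gi rg]]; exists g; split => // x xh.
have := rg x xh => /(congr1 fine) /= ->.
rewrite fineD//=.
apply: integrable_fin_num => //.
by move: xh; rewrite in_itv/= => /andP[? ?]; apply: itgS gi.
Qed.

Lemma density_W11 h rho g : density (- h) h rho g -> W11 h rho.
Proof.
move=> [gi rg]; exists g; split => // x xh.
rewrite {1}(rg x xh) EFinD; congr (_ + _)%E.
rewrite /Rintegral fineK//; apply: integrable_fin_num => //.
by move: xh; rewrite in_itv/= => /andP[? ?]; apply: itgS gi.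
Qed.

Lemma density_diff a b rho g x y : density a b rho g -> a <= x -> x <= y -> y <= b ->
  \int[mu]_(t in `[x, y]) g t = rho y - rho x.
Proof.
move=> [gi rg] ax xy yb.
rewrite (rg x) ?(rg y) ?in_itv/= ?ax ?(le_trans xy)// ?(le_trans ax)//.
rewrite (@Rint_cat a x y) ?ax//; last exact: itgS gi.
ring.
Qed.

Lemma density_continuous a b rho g : a <= b -> density a b rho g ->
  {within `[a, b], continuous rho}.
Proof.
move=> ab [gi rg].
have : {within `[a, b], continuous (cst (rho a) \+ (fun x => \int[mu]_(t in `[a, x]) g t))}.
  apply: within_continuousD; last exact: (parameterized_integral_continuous ab gi).
  by apply: continuous_subspaceT; exact: cst_continuous.
apply: subspace_eq_continuous => x /set_mem xab /=.
exact: esym (rg x xab).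
Qed.


Lemma within_continuousE a b f : {within `[a, b], continuous f} <->
  forall x, x \in `[a, b] -> forall e : R, 0 < e -> exists2 d : R, 0 < d &
    forall y, y \in `[a, b] -> `|y - x| < d -> `|f y - f x| < e.
Proof.
split=> [/subspace_continuousP cf x xab e e0|H].
  have /cvgrPdist_lt/(_ e e0) := cf x xab.
  rewrite near_withinE => -[d /= d0 D]; exists d => // y yab yx.
  by rewrite distrC; apply: D => //=; rewrite distrC.
apply/subspace_continuousP => x xab; apply/cvgrPdist_lt => e e0.
have [d d0 D] := H x xab e e0.
rewrite near_withinE; exists d => //= y /= yx yab.
by rewrite distrC; apply: D => //; rewrite distrC.
Qed.

Lemma density_ae a b rho g : density a b rho g ->
  {ae mu, forall x, x \in `]a, b[ -> derive1 rho x = g x}.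
Proof.
move=> [gi rg].
(* Extended by zero, g is locally integrable on the whole line, as the differentiation theorem
   requires. *)
set g0 := g \_ `[a, b].
have gi0 : mu.-integrable setT (EFin \o g0).
  by rewrite -restrict_EFin; apply/(integrable_mkcond _ _).1.
have gil : locally_integrable setT g0 by apply: integrable_locally.
have gi1 y : mu.-integrable [set` Interval (BLeft a) (BRight y)] (EFin \o g0).
  by apply: integrableS gi0.
have := @FTC1 R g0 (BLeft a) gi1 gil.
apply: filterS; first exact: (ae_filter_ringOfSetsType mu).
move=> x /= H; rewrite in_itv/= => /andP[ax xb].
move: H; rewrite lte_fin => /(_ ax) [].
set F := fun _ => _ => dF; rewrite /g0 patchE mem_set/=; last by rewrite in_itv/= !ltW.
move=> <-; rewrite !derive1E.
have -> : 'D_1 F x = 'D_1 (F + cst (rho a)) x.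
  by rewrite deriveD; [rewrite derive_cst addr0|exact: dF|exact: derivable_cst].
apply: near_eq_derive; near=> y.
have /andP[ay yb] : a < y < b by apply/andP; split; near: y; [exact: lt_nbhsr|exact: lt_nbhsl].
rewrite rg ?in_itv/= ?ltW// addrC; congr (_ + _).
apply: eq_Rintegral => t; rewrite inE/= in_itv/= => /andP[ta ty].
by rewrite /g0 patchE mem_set//= in_itv/= ta (le_trans ty)// ltW.
Unshelve. all: by end_near. Qed.

Lemma itg_mull a b f g : {within `[a, b], continuous f} -> itg a b g ->
  itg a b (fun x => f x * g x).
Proof.
move=> cf gi.
have mf : measurable_fun `[a, b] f by apply: subspace_continuous_measurable_fun.
have := @integrableMr _ _ _ mu `[a, b] (measurable_itv _) f (EFin \o g) mf _ gi.
apply.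
have /compact_bounded[M [_ mrt]] := continuous_compact cf (@segment_compact _ a b).
by exists M; split; rewrite ?num_real // => t /mrt H x /= xab; apply: H; exists x.
Qed.

Lemma le_norm_itg a b f g : measurable_fun `[a, b] f -> itg a b g ->
  (forall x, `|f x| <= 1 + `|g x|) -> itg a b f.
Proof.
move=> mf gi fg.
apply: (@le_itg a b f (fun x => 1 + `|g x|)) => //.
by apply: itgD; [exact: itg_cst|exact: itg_norm].
Qed.

(* Cousin's lemma. *)
Lemma local_to_global (a b : R) (G : R -> R -> Prop) : a <= b ->
  (forall x y z, a <= x -> x <= y -> y <= z -> z <= b -> G x y -> G y z -> G x z) ->
  (forall x, x \in `[a, b] -> exists2 d, 0 < d &
    forall y z, a <= y -> y <= x -> x <= z -> z <= b -> x - d < y -> z < x + d -> G y z) ->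
  G a b.
Proof.
move=> ab Gt Gl.
pose S := [set x | a <= x <= b /\ G a x].
have Sa : S a.
  split; first by rewrite lexx.
  have [|d d0] := Gl a; first by rewrite in_itv/= lexx.
  by apply; rewrite ?lexx// ?ltrBlDr ltrDl.
have Ss : has_sup S by split; [exists a|exists b => x [/andP[]]].
set s := sup S.
have as_ : a <= s by apply: sup_upper_bound.
have sb : s <= b by apply: ge_sup => //; [exists a|move=> x [/andP[]]].
have [|d d0 D] := Gl s; first by rewrite in_itv/= as_.
have [y [/andP[ay yb] Gy] yd] := sup_adherent d0 Ss.
have ys : y <= s by apply: sup_upper_bound => //; split => //; rewrite ay.
have Gs : G a s.
  by apply: (Gt _ y) => //; apply: D => //; rewrite ltrDl.
move: (sb); rewrite le_eqVlt => /predU1P[<- //|sltb].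
pose z := Num.min b (s + d / 2).
have sz : s < z by rewrite lt_min sltb ltrDl divr_gt0.
have zb : z <= b by rewrite ge_min lexx.
have Gz : G a z.
  apply: (Gt _ s) => //; first exact: ltW.
  apply: D => //; rewrite ?ltrBlDr ?ltrDl//; first exact: ltW.
  by rewrite /z gt_min ltrD2l ltr_pdivrMr// ltr_pMr// ltr1n orbT.
have : z <= s by apply: sup_upper_bound => //; split => //; rewrite zb andbT (le_trans as_)// ltW.
by rewrite leNgt sz.
Qed.

Lemma MVT_le (f df : R -> R) (a b : R) : (forall x, is_derive x 1 f (df x)) -> a <= b ->
  exists2 c, a <= c <= b & f b - f a = df c * (b - a).
Proof.
move=> fd ab.
have cf : {within `[a, b], continuous f}.
  apply: continuous_subspaceT => x.
  by apply/differentiable_continuous/derivable1_diffP; case: (fd x).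
have [c] := @MVT_segment R f df a b ab (fun x _ => fd x) cf.
by rewrite in_itv/= => abc ->; exists c.
Qed.

(** The chain rule for A along an absolutely continuous rho. On a short interval the mean value
    theorem writes the increment of A as W(eta) times the integral of g, and W(rho t) is within e of
    W(eta). The resulting error, e times the integral of |g|, is additive over intervals, so it
    passes to [[a, b]] by [local_to_global]. *)
Lemma density_chain a b rho g (A W : R -> R) : a <= b -> density a b rho g ->
  (forall y, is_derive y 1 A (W y)) -> continuous W ->
  \int[mu]_(t in `[a, b]) (W (rho t) * g t) = A (rho b) - A (rho a).
Proof.
move=> ab dg dA cW; have [gi rg] := dg.
have crho := density_continuous ab dg.
have cWr : {within `[a, b], continuous (W \o rho)}.
  by apply: within_continuous_comp crho => y _; exact: cW.
have Wgi : itg a b (fun x => W (rho x) * g x) by exact: itg_mull cWr gi.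
have agi : itg a b (fun x => `|g x|) by exact: integrable_norm gi.
suff H (e : R) : 0 < e ->
   `|\int[mu]_(t in `[a, b]) (W (rho t) * g t) - (A (rho b) - A (rho a))| <=
     e * \int[mu]_(t in `[a, b]) `|g t|.
  apply/eqP; rewrite -subr_eq0 -normr_le0; apply/ler_addgt0Pr => e e0.
  set G := \int[mu]_(t in `[a, b]) `|g t| in H.
  have G0 : 0 <= G by apply: Rintegral_ge0.
  (* The 1 covers the case G = 0. *)
  rewrite add0r (le_trans (H (e / (G + 1)) _))//; first by rewrite divr_gt0// ltr_pwDr.
  by rewrite mulrAC ler_pdivrMr ?ltr_pwDr// ler_pM2l// lerDl.
move=> e0.
pose P x y := `|\int[mu]_(t in `[x, y]) (W (rho t) * g t) - (A (rho y) - A (rho x))| <=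
     e * \int[mu]_(t in `[x, y]) `|g t|.
apply: (@local_to_global a b P ab).
  move=> x y z ax xy yz zb Pxy Pyz; rewrite /P.
  have xz : x <= y <= z by rewrite xy yz.
  rewrite (Rint_cat xz); last exact: itgS Wgi.
  rewrite (Rint_cat xz); last exact: itgS agi.
  rewrite mulrDr; apply: le_trans (lerD Pxy Pyz).
  apply: le_trans (ler_normD _ _); rewrite le_eqVlt; apply/orP; left; apply/eqP.
  congr (`| _ |); ring.
move=> x xab.
have e20 : 0 < e / 2 by rewrite divr_gt0.
have /cvgrPdist_lt/(_ _ e20)[d1 /= d10 D1] := cW (rho x).
have /within_continuousE/(_ x xab _ d10)[d d0 D] := crho.
exists d => // y z ay yx xz zb dy dz.
have yz : y <= z by exact: le_trans xz.
have near_rho t : y <= t <= z -> `|rho x - rho t| < d1.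
  move=> /andP[yt tz]; rewrite distrC; apply: D.
    by rewrite in_itv/= (le_trans ay)//= (le_trans tz).
  by rewrite ltr_distl (lt_le_trans dy)//= (le_lt_trans tz).
have [eta /andP[eta1 eta2] Ae] : exists2 eta, Num.min (rho y) (rho z) <= eta <= Num.max (rho y) (rho z) &
    A (rho z) - A (rho y) = W eta * (rho z - rho y).
  have [ryz|/ltW rzy] := leP (rho y) (rho z).
    exact: MVT_le.
  have [c c1 c2] := MVT_le dA rzy.
  by exists c => //; apply/eqP; rewrite -eqr_opp opprB c2 -mulrN opprB.
have We : `|W (rho x) - W eta| < e / 2.
  apply: D1 => /=; have := near_rho y; have := near_rho z.
  rewrite !lexx yz !ltr_distl => /(_ isT) /andP[z1 z2] /(_ isT) /andP[y1 y2].
  move: eta1 eta2; rewrite ge_min le_max => /orP e1 /orP e2.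
  apply/andP; split.
    by case: e2 => [le2|le2]; [lra|lra].
  by case: e1 => [le1|le1]; lra.
rewrite /P Ae -(density_diff dg)//.
have giyz : itg y z g by exact: itgS gi.
rewrite -RintegralZl// -RintegralB//; last 2 first.
- exact: itgS Wgi.
- exact: itgZ.
have fi : itg y z (fun t => W (rho t) * g t - W eta * g t).
  by apply: itgB; [exact: itgS Wgi|exact: itgZ].
apply: le_trans (le_normr_Rintegral _ fi) _ => //.
rewrite -RintegralZl//; last exact: itgS agi.
apply: le_Rintegral => //.
- exact: itg_norm.
- by apply: itgZ; exact: itgS agi.
move=> t /= ; rewrite in_itv/= => tyz.
rewrite -mulrBl normrM ler_wpM2r//.
have /ltW := D1 _ (near_rho t tyz).
move/ltW : We; rewrite !ler_distl => /andP[? ?] /andP[? ?].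
by apply/andP; split; lra.
Qed.

Lemma primitive_density (A W : R -> R) a b : (forall y, is_derive y 1 A (W y)) ->
  continuous W -> density a b A W.
Proof.
move=> dA cW; split; first by apply: continuous_itg; exact: continuous_subspaceT.
move=> x; rewrite in_itv/= => /andP[ax xb].
have cA : continuous A.
  by move=> y; apply/differentiable_continuous/derivable1_diffP; case: (dA y).
move: ax; rewrite le_eqVlt => /predU1P[<-|ax].
  by rewrite set_itv1 Rintegral_set1 addr0.
rewrite /Rintegral (@continuous_FTC2 _ W A a x ax) /=.
- by rewrite subrKC.
- exact: continuous_subspaceT.
- split.
  + by move=> y _; case: (dA y).
  + by apply: cvg_at_right_filter; exact: cA.
  + by apply: cvg_at_left_filter; exact: cA.
- by move=> y _; rewrite derive1E; apply: derive_val.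
Qed.

End Density.

(** * One-variable calculus *)

Section Calculus.
Variable R : realType.
Implicit Types (f g : R -> R) (x y a b : R).

Lemma der_eq f x a b : is_derive x 1 f a -> a = b -> is_derive x 1 f b.
Proof. by move=> + <-. Qed.

Lemma der_cst (k x : R) : is_derive x 1 (fun _ : R => k) (0 : R).
Proof. exact: is_derive_cst. Qed.

Lemma der_id x : is_derive x 1 (fun y : R => y) (1 : R).
Proof. exact: is_derive_id. Qed.

Lemma derD f g x a b : is_derive x 1 f a -> is_derive x 1 g b ->
  is_derive x 1 (fun y => f y + g y) (a + b).
Proof. exact: is_deriveD. Qed.

Lemma derN f x a : is_derive x 1 f a -> is_derive x 1 (fun y => - f y) (- a).
Proof. exact: is_deriveN. Qed.

Lemma derM f g x a b : is_derive x 1 f a -> is_derive x 1 g b ->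
  is_derive x 1 (fun y => f y * g y) (a * g x + f x * b).
Proof.
move=> fa gb; apply: (der_eq (is_deriveM fa gb)).
by rewrite /GRing.scale/= addrC [g x * a]mulrC.
Qed.

Lemma derC f g x a b : is_derive (g x) 1 f a -> is_derive x 1 g b ->
  is_derive x 1 (fun y => f (g y)) (a * b).
Proof. exact: is_derive1_comp. Qed.

Lemma derV f x a : f x != 0 -> is_derive x 1 f a ->
  is_derive x 1 (fun y => (f y)^-1) (- a / f x ^+ 2).
Proof.
move=> f0 fa; apply: (der_eq (is_deriveV f0 fa)).
by rewrite /GRing.scale/= mulNr mulrC mulNr.
Qed.

Lemma derX f n x a : is_derive x 1 f a ->
  is_derive x 1 (fun y => f y ^+ n.+1) (n.+1%:R * f x ^+ n * a).
Proof.
move=> fa; elim: n => [|n IH]; first by rewrite expr0 mulr1 mul1r.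
rewrite (_ : (fun y => f y ^+ n.+2) = (fun y => f y * f y ^+ n.+1)).
  by apply: (der_eq (derM fa IH)); rewrite -[in RHS]natr1 exprS; ring.
by apply/funext => y; rewrite exprS.
Qed.

Lemma derS f x a : 0 < f x -> is_derive x 1 f a ->
  is_derive x 1 (fun y => Num.sqrt (f y)) (a / (2 * Num.sqrt (f x))).
Proof.
by move=> f0 fa; apply: (der_eq (derC (is_derive1_sqrt f0) fa)); rewrite mulrC.
Qed.

Lemma derE f x a : is_derive x 1 f a ->
  is_derive x 1 (fun y => expR (f y)) (a * expR (f x)).
Proof.
by move=> fa; apply: (der_eq (derC (is_derive_expR (f x)) fa)); rewrite mulrC.
Qed.

Lemma derL f x a : 0 < f x -> is_derive x 1 f a ->
  is_derive x 1 (fun y => ln (f y)) (a / f x).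
Proof.
by move=> f0 fa; apply: (der_eq (derC (is_derive1_ln f0) fa)); rewrite mulrC.
Qed.

Lemma der_continuous f x a : is_derive x 1 f a -> {for x, continuous f}.
Proof. by move=> [fa _]; apply/differentiable_continuous/derivable1_diffP. Qed.

Lemma der_cont f (df : R -> R) : (forall x, is_derive x 1 f (df x)) -> continuous f.
Proof. by move=> H x; exact: der_continuous (H x). Qed.

Lemma MVT_lt (f df : R -> R) (a b : R) : a < b ->
  (forall x, a < x < b -> is_derive x 1 f (df x)) -> {within `[a, b], continuous f} ->
  exists2 c, a < c < b & f b - f a = df c * (b - a).
Proof.
move=> ab fd cf.
have fd' x : x \in `]a, b[ -> is_derive x 1 f (df x) by rewrite in_itv/=; exact: fd.
have [c cab e] := MVT ab fd' cf.
by exists c => //; move: cab; rewrite in_itv.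
Qed.

Lemma der_lt (f df : R -> R) (a b : R) : a < b ->
  (forall x, a < x < b -> is_derive x 1 f (df x)) -> {within `[a, b], continuous f} ->
  (forall x, a < x < b -> 0 < df x) -> f a < f b.
Proof.
move=> ab fd cf df0; have [c cab e] := MVT_lt ab fd cf.
by rewrite -subr_gt0 e mulr_gt0 ?df0// subr_gt0.
Qed.

Lemma der_le (f df : R -> R) (a b : R) : a <= b ->
  (forall x, a < x < b -> is_derive x 1 f (df x)) -> {within `[a, b], continuous f} ->
  (forall x, a < x < b -> 0 <= df x) -> f a <= f b.
Proof.
rewrite le_eqVlt => /predU1P[->//|ab] fd cf df0; have [c cab e] := MVT_lt ab fd cf.
by rewrite -subr_ge0 e mulr_ge0 ?df0// subr_ge0 ltW.
Qed.

Lemma der_cst_in (f : R -> R) (a b : R) : a <= b ->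
  (forall x, a < x < b -> is_derive x 1 f 0) -> {within `[a, b], continuous f} ->
  f a = f b.
Proof.
rewrite le_eqVlt => /predU1P[->//|ab] fd cf.
have [c _ /eqP] := MVT_lt (df := fun=> 0) ab fd cf.
by rewrite mul0r subr_eq0 => /eqP.
Qed.

(** Chosen among all primitives on the whole line, because the integral over [[a, y]] only serves
    for y above a. *)
Definition primitive (a : R) f : R -> R :=
  get [set A | (forall y, is_derive y 1 A (f y)) /\ A a = 0].

Lemma primitiveP a f : continuous f ->
  (forall y, is_derive y 1 (primitive a f) (f y)) /\ primitive a f a = 0.
Proof.
move=> cf; suff [A AP] : exists A, (forall y, is_derive y 1 A (f y)) /\ A a = 0.
  by have := @getPex _ [set A | (forall y, is_derive y 1 A (f y)) /\ A a = 0] (ex_intro _ A AP).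
pose mu := @lebesgue_measure R.
have fi x y : itg x y f by apply: continuous_itg; exact: continuous_subspaceT.
pose G b y := \int[mu]_(t in `[b, y]) f t - \int[mu]_(t in `[b, a]) f t.
have GE b b' y : b <= b' -> b' < y -> b' < a -> G b y = G b' y.
  move=> bb by_ ba; rewrite /G (@Rint_cat _ b b' y) ?bb ?ltW// (@Rint_cat _ b b' a) ?bb ?ltW//.
  ring.
(* The base point has to lie below both y and a, so it moves with y; by [GE] its position does not
   affect the value. *)
pose A y := G (Num.min y a - 1) y.
have mlt x : Num.min x a - 1 < x.
  by rewrite (@lt_le_trans _ _ (Num.min x a)) ?gtrBl// ge_min lexx.
have mla x : Num.min x a - 1 < a.
  by rewrite (@lt_le_trans _ _ (Num.min x a)) ?gtrBl// ge_min lexx orbT.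
exists A; split; last by rewrite /A /G subrr.
(* This fixed base point lies below the moving ones of all z > y - 1, so near y the function A
   coincides with [G b]. *)
move=> y; set b := Num.min y a - 2.
have by_ : b < y by apply: lt_trans (mlt y); rewrite /b ltrD2l ltrN2 ltr1n.
have dG : is_derive y 1 (G b) (f y).
  have [] := @continuous_FTC1_closed R f b y (y + 1) _ (fi _ _) by_ (cf y); first by rewrite ltrDl.
  rewrite derive1E => d1 d2.
  have d3 := @DeriveDef _ _ _ _ _ _ _ d1 d2.
  by apply: (der_eq (derD d3 (der_cst (- \int[mu]_(t in `[b, a]) f t) y))); rewrite addr0.
apply: near_eq_is_derive dG; near=> z.
rewrite /A (@GE b (Num.min z a - 1) z)//.
rewrite /b lerBrDr; apply: (@le_trans _ _ (Num.min y a - 1)); first by rewrite -addrA lerD2l; lra.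
rewrite le_min !lerBlDr; apply/andP; split.
  apply: (@le_trans _ _ y); first by rewrite ge_min lexx.
  by rewrite -lerBlDr ltW//; near: z; apply: lt_nbhsr; rewrite gtrBl.
by rewrite ge_min lerDl ler01 orbT.
Unshelve. all: by end_near. Qed.

Definition inverse f : R -> R := get [set g | forall x, f (g x) = x].

Lemma inverseP f : continuous f -> {homo f : x y / x < y} ->
  (forall M, exists x, f x <= M) -> (forall M, exists x, M <= f x) ->
  [/\ forall x, f (inverse f x) = x, forall x, inverse f (f x) = x,
      continuous (inverse f), {homo inverse f : x y / x < y} &
      forall x l, is_derive x 1 f l -> l != 0 -> is_derive (f x) 1 (inverse f) l^-1].
Proof.
move=> cf hf lo hi.
have fle x y : f x <= f y -> x <= y.
  by move=> fxy; rewrite leNgt; apply/negP => /hf; rewrite ltNge fxy.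
have fK1 : forall x, f (inverse f x) = x.
  rewrite /inverse; apply: (@getPex _ [set g | forall x, f (g x) = x]).
  have H y : exists x, f x = y.
    have [a fa] := lo y; have [b fb] := hi y.
    have ab : a <= b by apply: fle; exact: le_trans fb.
    have [||c _ fc] := @IVT R f a b y ab; last by exists c.
      exact: continuous_subspaceT.
    by rewrite ge_min le_max fa fb orbT.
  by have [g gP] := choice H; exists g.
have fK : forall x, inverse f (f x) = x.
  by move=> x; apply/eqP; rewrite eq_le; apply/andP; split; apply: fle; rewrite fK1.
have cg y : {for y, continuous (inverse f)}.
  rewrite -(fK1 y).
  by apply: (nbhs_singleton (near_can_continuous _ _)); near=> z.
split => //.
  by move=> x y xy; rewrite ltNge; apply/negP => h; move: xy; rewrite ltNge -(fK1 x) -(fK1 y) => /negP; apply;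
    move: h; rewrite le_eqVlt => /predU1P[->//|/hf/ltW].
move=> x l dx l0; apply: is_derive_inverse dx l0; by near=> z.
Unshelve. all: by end_near. Qed.

End Calculus.

(* Leaves the atomic functions and the side conditions to the user. *)
Ltac der := cbv beta;
  lazymatch goal with |- @is_derive _ _ _ ?x _ ?F _ =>
  lazymatch F with
  | (fun y => y) => exact (der_id x)
  | (fun _ => ?k) => exact (der_cst k x)
  | (fun y => @?f y + @?g y) => notypeclasses refine (@derD _ f g x _ _ _ _); [der|der]
  | (fun y => - @?f y) => notypeclasses refine (@derN _ f x _ _); der
  | (fun y => @?f y * @?g y) => notypeclasses refine (@derM _ f g x _ _ _ _); [der|der]
  | (fun y => (@?f y)^-1) => notypeclasses refine (@derV _ f x _ _ _); [cbv beta|der]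
  | (fun y => @?f y ^+ (S ?n)) => notypeclasses refine (@derX _ f n x _ _); der
  | (fun y => Num.sqrt (@?f y)) => notypeclasses refine (@derS _ f x _ _ _); [cbv beta|der]
  | (fun y => expR (@?f y)) => notypeclasses refine (@derE _ f x _ _); der
  | (fun y => ln (@?f y)) => notypeclasses refine (@derL _ f x _ _ _); [cbv beta|der]
  | _ => idtac
  end end.
Ltac deriv := notypeclasses refine (@der_eq _ _ _ _ _ _ _); [der|cbv beta].

(** * The Lagrangian and its extremals *)

Section Extremal.
Variable R : realType.
Implicit Types (c m y p z x : R).

Definition slope_norm p : R := Num.sqrt (1 + p ^+ 2).
Local Notation S := slope_norm.

Lemma slope_norm_gt0 p : 0 < S p.
Proof. by rewrite sqrtr_gt0 ltr_wpDr// sqr_ge0. Qed.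

Lemma slope_norm_neq0 p : S p != 0. Proof. by rewrite gt_eqF// slope_norm_gt0. Qed.

Lemma slope_norm_sqr p : S p ^+ 2 = 1 + p ^+ 2.
Proof. by rewrite sqr_sqrtr// addr_ge0// sqr_ge0. Qed.

Lemma slope_norm_ge1 p : 1 <= S p.
Proof.
have := slope_norm_sqr p; have := slope_norm_gt0 p; have := sqr_ge0 p; nra.
Qed.

Lemma slope_norm_gtnorm p : `|p| < S p.
Proof. by rewrite -sqrtr_sqr ltr_sqrt ?ltrDr// ltr_wpDr// sqr_ge0. Qed.

Lemma slope_norm_le p : S p <= 1 + `|p|.
Proof.
rewrite -[leRHS]ger0_norm ?addr_ge0// -sqrtr_sqr ler_sqrt ?sqr_ge0//.
by rewrite sqrrD expr1n mul1r real_normK ?num_real// -addrA lerD2l lerDr mulrn_wge0.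
Qed.

Lemma slope_norm_even p : S (- p) = S p. Proof. by rewrite /S sqrrN. Qed.

Lemma slope_norm0 : S 0 = 1. Proof. by rewrite /S expr0n addr0 sqrtr1. Qed.

Lemma der_slope_norm p : is_derive p 1 S (p / S p).
Proof.
have h : 0 < 1 + p ^+ 2 by rewrite ltr_wpDr// sqr_ge0.
rewrite /S; deriv.
- exact: h.
- by rewrite -/(S p); field; exact: slope_norm_neq0.
Qed.

Lemma slope_norm_continuous : continuous S.
Proof. exact: der_cont der_slope_norm. Qed.

Definition lagr c y p : R := y * S p + c * (p ^+ 2 / (y * S p)).
(** The partial derivative of [lagr] in p, simplified with S(p)^2 = 1 + p^2. *)
Definition lagr_p c y p : R := y * (p / S p) + c / y * (p * (2 + p ^+ 2) / S p ^+ 3).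

(* The positive root y of y^2 - m S(p) y - c p^2 / S(p)^2 = 0, which is the first
   integral lagr - p * lagr_p = m solved for y. *)
Definition height c m p : R :=
  (m * S p + Num.sqrt ((m * S p) ^+ 2 + 4 * c * (p / S p) ^+ 2)) / 2.
Local Notation Y := height.

(** * The extremal with minimum m, parametrized by its slope *)

Section Curve.
Variables (c m : R) (c0 : 0 <= c) (m0 : 0 < m).

Let disc p := (m * S p) ^+ 2 + 4 * c * (p / S p) ^+ 2.
Let disc_gt0 p : 0 < disc p.
Proof. have h : 0 < (m * S p) ^+ 2 by rewrite exprn_gt0// mulr_gt0// slope_norm_gt0.
by rewrite ltr_wpDr// mulr_ge0 ?sqr_ge0// mulr_ge0. Qed.

Lemma height_quad p : Y c m p ^+ 2 = m * S p * Y c m p + c * (p / S p) ^+ 2.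
Proof.
rewrite /Y -/(disc p).
have := sqr_sqrtr (ltW (disc_gt0 p)); rewrite [X in _ = X]/disc.
set d := Num.sqrt _; set u := m * S p; set w := p / S p => dd.
have -> : c * w ^+ 2 = (d ^+ 2 - u ^+ 2) / 4 by rewrite dd; field.
by field.
Qed.

Lemma height_ge p : m * S p <= Y c m p.
Proof.
rewrite /Y -/(disc p) ler_pdivlMr// mulr_natr mulr2n lerD2l.
rewrite -[leLHS]ger0_norm; last by rewrite mulr_ge0// ltW// slope_norm_gt0.
rewrite -sqrtr_sqr ler_sqrt ?(ltW (disc_gt0 p))//.
by rewrite lerDl mulr_ge0 ?sqr_ge0// mulr_ge0.
Qed.

Lemma height_ge_m p : m <= Y c m p.
Proof. by apply: le_trans (height_ge p); rewrite ler_peMr ?slope_norm_ge1// ltW. Qed.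

Lemma height_gt0 p : 0 < Y c m p.
Proof. exact: lt_le_trans (height_ge_m p). Qed.

Lemma height0 : Y c m 0 = m.
Proof.
rewrite /Y slope_norm0 mul0r expr0n mulr0 addr0 mulr1 sqrtr_sqr gtr0_norm//; by field.
Qed.

Lemma height_even p : Y c m (- p) = Y c m p.
Proof. by rewrite /Y slope_norm_even mulNr sqrrN. Qed.

Lemma first_integral p : m = Y c m p / S p - c * p ^+ 2 / (Y c m p * S p ^+ 3).
Proof.
have := height_quad p; have := height_gt0 p; have := slope_norm_gt0 p.
set y := Y c m p; set s := S p => s0 y0 e.
apply: (mulIf (lt0r_neq0 (mulr_gt0 s0 y0))).
have -> : m * (s * y) = y ^+ 2 - c * (p / s) ^+ 2 by rewrite e; ring.
by field; rewrite !gt_eqF.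
Qed.

(** This is dx/dp along the extremal: dY = p dx gives Y'(p) / p, and the factor p is cancelled here,
    so the quotient is regular and positive at p = 0 too. The denominator is the square root in
    [height]. *)
Definition speed p : R :=
  (m * Y c m p / S p + 2 * c / S p ^+ 4) / (2 * Y c m p - m * S p).
Local Notation V := speed.

Let den_ge p : m <= 2 * Y c m p - m * S p.
Proof. by have := height_ge p; have := height_ge_m p; lra. Qed.

Let den_gt0 p : 0 < 2 * Y c m p - m * S p.
Proof. exact: lt_le_trans (den_ge p). Qed.

Lemma speed_lb p : m / (2 * S p) <= V p.
Proof.
rewrite /V ler_pdivlMr//.
have y0 := height_gt0 p; have s0 := slope_norm_gt0 p.
apply: (@le_trans _ _ (m * Y c m p / S p)); last first.
  by rewrite lerDl mulr_ge0 ?mulr_ge0// invr_ge0 exprn_ge0// ltW.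
rewrite ler_pdivlMr//.
have -> : m / (2 * S p) * (2 * Y c m p - m * S p) * S p = m * Y c m p - m ^+ 2 * S p / 2.
  by field; rewrite gt_eqF.
by rewrite gerBl divr_ge0// mulr_ge0// ?sqr_ge0// ltW.
Qed.

Lemma speed_gt0 p : 0 < V p.
Proof. by apply: lt_le_trans (speed_lb p); rewrite divr_gt0// mulr_gt0// slope_norm_gt0. Qed.

Lemma speed_ub p : V p <= m + 2 * c / m.
Proof.
rewrite /V ler_pdivrMr//.
have y0 := height_gt0 p; have s1 := slope_norm_ge1 p; have s0 := slope_norm_gt0 p.
have h1 : m * Y c m p / S p <= m * Y c m p.
  by rewrite ler_pdivrMr// ler_peMr// mulr_ge0// ltW.
have h2 : 2 * c / S p ^+ 4 <= 2 * c.
  by rewrite ler_pdivrMr ?exprn_gt0// ler_peMr ?mulr_ge0// exprn_ege1.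
have h3 := height_ge p.
have h4 : Y c m p <= 2 * Y c m p - m * S p by lra.
rewrite [leRHS]mulrDl; apply: lerD.
  by apply: le_trans h1 _; rewrite ler_pM2l.
apply: le_trans h2 _.
rewrite -[leRHS]mulrA ler_peMr ?mulr_ge0// mulrC ler_pdivlMr// mul1r.
exact: den_ge.
Qed.

Lemma speed_even p : V (- p) = V p.
Proof. by rewrite /V height_even slope_norm_even. Qed.

Lemma der_height p : is_derive p 1 (Y c m) (p * V p).
Proof.
have s0 := slope_norm_gt0 p; have d0 := disc_gt0 p.
have -> : Y c m = fun p => (m * S p + Num.sqrt (disc p)) / 2 by [].
rewrite /disc; deriv; [exact: der_slope_norm|exact: disc_gt0|exact: der_slope_norm|exact: slope_norm_neq0|exact: der_slope_norm|].
rewrite -/(disc p).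
have r0 : Num.sqrt (disc p) != 0 by rewrite gt_eqF// sqrtr_gt0.
have e : 2 * Y c m p - m * S p = Num.sqrt (disc p) by rewrite /Y -/(disc p); field.
have e2 : Y c m p = (m * S p + Num.sqrt (disc p)) / 2 by [].
rewrite /V e e2; set r := Num.sqrt _ in r0 *.
have := slope_norm_sqr p; set s := S p => ss.
have -> : (p * (- (p / s) / s ^+ 2)) = (p * - (p / s) / s ^+ 2) by rewrite mulrA.
have -> : 1 / s + p * - (p / s) / s ^+ 2 = 1 / s ^+ 3.
  have -> : 1 / s + p * - (p / s) / s ^+ 2 = (s ^+ 2 - p ^+ 2) / s ^+ 3 by field; rewrite gt_eqF.
  by rewrite ss addrK.
have sn : s != 0 := slope_norm_neq0 p.
by field; rewrite sn r0.
Qed.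

Lemma height_continuous : continuous (Y c m).
Proof. exact: der_cont der_height. Qed.

Lemma speed_continuous : continuous V.
Proof.
move=> p; have s0 := slope_norm_neq0 p; have d := den_gt0 p.
notypeclasses refine (@der_continuous _ V p _ _); rewrite /V.
by der; [exact: der_height|exact: s0|exact: der_slope_norm|exact: expf_neq0|exact: der_slope_norm|rewrite gt_eqF|exact: der_height|exact: der_slope_norm].
Qed.

Lemma height_lt p1 p2 : 0 <= p1 -> p1 < p2 -> Y c m p1 < Y c m p2.
Proof.
move=> p10 p12; apply: (@der_lt _ _ (fun p => p * V p)) => //.
- by move=> x _; exact: der_height.
- by apply: continuous_subspaceT; exact: height_continuous.
- by move=> x /andP[p1x _]; rewrite mulr_gt0 ?speed_gt0// (le_lt_trans p10).
Qed.

Lemma height_le p1 p2 : 0 <= p1 -> p1 <= p2 -> Y c m p1 <= Y c m p2.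
Proof. by move=> p10; rewrite le_eqVlt => /predU1P[->//|/(height_lt p10)/ltW]. Qed.

(* The excess is a sum of two nonnegative terms, namely S(z) * ((m / cos t) * (1 - cos
   (f - t)) + (c / y) * (sin f - sin t)^2) for z = tan f and p = tan t. *)
Lemma excessE p z : lagr c (Y c m p) z - m - z * lagr_p c (Y c m p) p =
  m * (S p * S z - (1 + z * p)) + c / Y c m p * S z * (z / S z - p / S p) ^+ 2.
Proof.
have y0 := height_gt0 p; have s0 := slope_norm_gt0 p; have t0 := slope_norm_gt0 z.
rewrite /lagr /lagr_p {3 6}(first_integral p).
have ps : p ^+ 2 = S p ^+ 2 - 1 by rewrite slope_norm_sqr addrC addKr.
have zs : z ^+ 2 = S z ^+ 2 - 1 by rewrite slope_norm_sqr addrC addKr.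
rewrite sqrrB !expr_div_n ps zs.
have -> : z * (Y c m p * (p / S p) + c / Y c m p * (p * (2 + (S p ^+ 2 - 1)) / S p ^+ 3)) =
  (z * p) * (Y c m p * (1 / S p) + c / Y c m p * ((2 + (S p ^+ 2 - 1)) / S p ^+ 3)) by ring.
have -> : (z / S z) * (p / S p) = (z * p) / (S z * S p) by field; rewrite !gt_eqF.
move: (Y c m p) (S p) (S z) (z * p) y0 s0 t0 => y s t w y0 s0 t0.
by field; rewrite !gt_eqF.
Qed.

(** Cauchy-Schwarz for the vectors (1, p) and (1, z); [dot_eq] is its equality case. *)
Lemma dot_le p z : 1 + z * p <= S p * S z.
Proof.
have h : 0 <= (z - p) ^+ 2 := sqr_ge0 _.
apply: (@le_trans _ _ `|1 + z * p|); first exact: ler_norm.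
rewrite -(@ger0_norm _ (S p * S z)); last by rewrite mulr_ge0// ltW// slope_norm_gt0.
rewrite -ler_sqr ?nnegrE// !real_normK ?num_real// exprMn !slope_norm_sqr; nra.
Qed.

Lemma dot_eq p z : S p * S z = 1 + z * p -> z = p.
Proof.
move=> /(congr1 (fun x => x ^+ 2)); rewrite exprMn !slope_norm_sqr => e.
have : (z - p) ^+ 2 == 0 by apply/eqP; nra.
by rewrite sqrf_eq0 subr_eq0 => /eqP.
Qed.

Lemma excess_ge0 p z : 0 <= lagr c (Y c m p) z - m - z * lagr_p c (Y c m p) p.
Proof.
rewrite excessE addr_ge0//.
  by rewrite mulr_ge0 ?(ltW m0)// subr_ge0 dot_le.
rewrite mulr_ge0 ?sqr_ge0// mulr_ge0 ?(ltW (slope_norm_gt0 z))//.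
by rewrite divr_ge0// ltW// height_gt0.
Qed.

Lemma excess_eq0 p z : lagr c (Y c m p) z - m - z * lagr_p c (Y c m p) p = 0 -> z = p.
Proof.
rewrite excessE => /eqP; rewrite paddr_eq0; last 2 first.
- by rewrite mulr_ge0 ?(ltW m0)// subr_ge0 dot_le.
- rewrite mulr_ge0 ?sqr_ge0// mulr_ge0 ?(ltW (slope_norm_gt0 z))//.
  by rewrite divr_ge0// ltW// height_gt0.
by rewrite mulf_eq0 gt_eqF//= subr_eq0 => /andP[/eqP /dot_eq].
Qed.

Lemma excess_self p : lagr c (Y c m p) p - m = p * lagr_p c (Y c m p) p.
Proof.
apply/eqP; rewrite -subr_eq0 excessE subrr expr0n mulr0 addr0.
by rewrite -expr2 slope_norm_sqr expr2 subrr mulr0.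
Qed.

(** The Euler-Lagrange equation at slope p, where the second derivative of the extremal is 1 / V(p),
    multiplied by V(p). *)
Lemma speed_EL p : V p * ((1 + p ^+ 2) * ((c + Y c m p ^+ 2) * p ^+ 2 + Y c m p ^+ 2)) =
  Y c m p * (Y c m p ^+ 2 * p ^+ 2 + c * (2 - p ^+ 2) + Y c m p ^+ 2).
Proof.
have y0 := height_gt0 p; have s0 := slope_norm_gt0 p; have d := den_gt0 p.
rewrite /V; apply: (mulIf (lt0r_neq0 d)).
rewrite -[LHS]mulrA [X in _ * X]mulrC mulrA divfK ?gt_eqF//.
have me := first_integral p.
have ps : p ^+ 2 = S p ^+ 2 - 1 by rewrite slope_norm_sqr addrC addKr.
rewrite !ps in me *; rewrite !{1}[in m * _]me; move: (Y c m p) (S p) y0 s0 => y s y0 s0.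
by field; rewrite !gt_eqF.
Qed.

(** Position as a function of slope, measured from the minimum point. *)
Definition abscissa := primitive 0 V.
Local Notation X := abscissa.

Lemma der_abscissa p : is_derive p 1 X (V p).
Proof. by have [+ _] := primitiveP 0 speed_continuous; apply. Qed.

Lemma abscissa0 : X 0 = 0.
Proof. by have [] := primitiveP 0 speed_continuous. Qed.

Lemma abscissa_continuous : continuous X.
Proof. exact: der_cont der_abscissa. Qed.

Lemma abscissa_lt p1 p2 : p1 < p2 -> X p1 < X p2.
Proof.
move=> p12; apply: (@der_lt _ _ V) => //.
- by move=> x _; exact: der_abscissa.
- by apply: continuous_subspaceT; exact: abscissa_continuous.
- by move=> x _; exact: speed_gt0.
Qed.

Lemma abscissa_odd p : X (- p) = - X p.
Proof.
have H (q : R) : is_derive q 1 (fun q => X (- q) + X q) 0.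
  apply: (der_eq (derD (derC (der_abscissa _) (derN (der_id _))) (der_abscissa _))).
  by rewrite speed_even; ring.
have := is_derive_0_is_cst p 0 H.
by rewrite /= oppr0 abscissa0 addr0 => /eqP; rewrite addr_eq0 => /eqP.
Qed.

(** Since S(p) <= 1 + p, [speed_lb] gives V(p) >= m / (2 (1 + p)), whose integral diverges. Hence
    the position takes every real value, and the slope is a function of x on the whole line. *)
Lemma abscissa_ln p : 0 <= p -> m / 2 * ln (1 + p) <= X p.
Proof.
move=> p0; have d x : 0 < x < p -> is_derive x 1 (fun x => X x - m / 2 * ln (1 + x)) (V x - m / 2 / (1 + x)).
  move=> /andP[x0 _]; deriv; [exact: der_abscissa|by rewrite addr_gt0|].
  by field; rewrite gt_eqF// addr_gt0.
have := der_le p0 d; rewrite abscissa0 addr0 ln1 mulr0 subrr subr_ge0; apply.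
  apply/within_continuousE => x; rewrite in_itv/= => /andP[x0 xp].
  suff cx : {for x, continuous (fun x => X x - m / 2 * ln (1 + x))}.
    move=> e e0; have /cvgrPdist_lt/(_ _ e0)[dl /= dl0 D] := cx.
    by exists dl => // y _ yx; rewrite distrC; apply: D => /=; rewrite distrC.
  apply: (@der_continuous _ (fun x => X x - m / 2 * ln (1 + x))).
  by der; [exact: der_abscissa|rewrite ltr_pwDl].
move=> x /andP[x0 _]; rewrite subr_ge0; apply: le_trans (speed_lb x).
rewrite -mulrA -invfM ler_pM2l// lef_pV2 ?posrE ?mulr_gt0 ?slope_norm_gt0 ?addr_gt0//.
by rewrite ler_pM2l//; have := slope_norm_le x; rewrite gtr0_norm.
Qed.

Definition slope_at := inverse X.
Local Notation Z := slope_at.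

Lemma abscissa_unbounded M : exists x, M <= X x.
Proof.
exists (expR (`|M| * 2 / m) - 1).
have h : 0 <= `|M| * 2 / m by rewrite !mulr_ge0// invr_ge0 ltW.
have := abscissa_ln (p := expR (`|M| * 2 / m) - 1).
rewrite subr_ge0 -[X in X <= expR _]expR0 ler_expR h subrKC => /(_ isT).
rewrite expRK (_ : m / 2 * _ = `|M|); last by field; rewrite gt_eqF.
by apply: le_trans; exact: ler_norm.
Qed.

Lemma slope_atP : [/\ forall x, X (Z x) = x, forall x, Z (X x) = x,
   continuous Z, {homo Z : x y / x < y} &
   forall x, is_derive x 1 Z (V (Z x))^-1].
Proof.
have [||a b cc d e] := inverseP abscissa_continuous abscissa_lt.
- move=> M; have [x Mx] := abscissa_unbounded (- M); exists (- x).
  by rewrite abscissa_odd lerNl.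
- exact: abscissa_unbounded.
split => // x; rewrite -{1}(a x); apply: e; first exact: der_abscissa.
by rewrite gt_eqF// speed_gt0.
Qed.

Lemma slope_at0 : Z 0 = 0.
Proof. by have [_ h _ _ _] := slope_atP; have := h 0; rewrite abscissa0. Qed.

Lemma slope_at_odd x : Z (- x) = - Z x.
Proof. by have [a b _ _ _] := slope_atP; rewrite -{1}(a x) -abscissa_odd b. Qed.

Definition extremal x := Y c m (Z x).

Lemma extremal0 : extremal 0 = m.
Proof. by rewrite /extremal slope_at0 height0. Qed.

Lemma extremal_even x : extremal (- x) = extremal x.
Proof. by rewrite /extremal slope_at_odd height_even. Qed.

(** Y' = p V and Z' = 1 / V: the parameter p really is the slope of the extremal. *)
Lemma der_extremal x : is_derive x 1 extremal (Z x).
Proof.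
have [_ _ _ _ d] := slope_atP; apply: (der_eq (derC (der_height _) (d x))).
by rewrite mulfK// gt_eqF// speed_gt0.
Qed.

End Curve.
End Extremal.

(** * Calibration and the reduced energy *)

Section Calibration.
Variable R : realType.
Implicit Types (c m y p z x : R).
Local Notation S := (@slope_norm R).
Local Notation Y := (@height R).
Local Notation V := (@speed R).
Local Notation X := (@abscissa R).
Local Notation Z := (@slope_at R).

Definition pos_part p : R := (p + `|p|) / 2.
Local Notation pos := pos_part.

Lemma pos_ge0 p : 0 <= pos p.
Proof. by rewrite divr_ge0// -lerBlDl sub0r -normrN ler_norm. Qed.

Lemma posP p : 0 <= p -> pos p = p.
Proof. by move=> p0; rewrite /pos ger0_norm//; field. Qed.

Lemma posN p : p <= 0 -> pos p = 0.
Proof. by move=> p0; rewrite /pos ler0_norm// subrr mul0r. Qed.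

Lemma pos_continuous : continuous pos.
Proof.
move=> p; apply: (@continuousM R R (fun p => p + `|p|) (fun=> 2^-1)); last exact: cst_continuous.
by apply: (@continuousD _ _ _ (fun p : R => p)); [exact: cvg_id|exact: norm_continuous].
Qed.

(* The linear continuation below m makes the height profile a bijection of the line. *)
Definition height_ext c m p : R := Y c m (pos p) + (p - pos p).
Local Notation Ye := height_ext.

(** * The calibrating field for a fixed minimum m *)

Section Fixed.
Variables (c m : R) (c0 : 0 <= c) (m0 : 0 < m).

Let YeP p : 0 <= p -> Ye c m p = Y c m p.
Proof. by move=> p0; rewrite /Ye posP// subrr addr0. Qed.

Let YeN p : p <= 0 -> Ye c m p = m + p.
Proof. by move=> p0; rewrite /Ye posN// subr0 height0. Qed.

Let Ye_cont : continuous (Ye c m).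
Proof.
move=> p; apply: (@continuousD _ _ _ (fun p => Y c m (pos p)) (fun p => p - pos p)).
  apply: (@continuous_comp _ _ _ pos (Y c m)); first exact: pos_continuous.
  exact: height_continuous.
by apply: (@continuousB _ _ _ (fun p : R => p) pos); [exact: cvg_id|exact: pos_continuous].
Qed.

Let Ye_lt : {homo Ye c m : x y / x < y}.
Proof.
move=> x y xy; have [x0|x0] := leP 0 x.
  by rewrite !YeP ?(le_trans x0 (ltW xy))// height_lt.
rewrite (YeN (ltW x0)); have [y0|y0] := leP 0 y; last by rewrite (YeN (ltW y0)) ltrD2l.
by rewrite YeP// (@lt_le_trans _ _ m) ?gtrDl// height_ge_m.
Qed.

Let Ye_inv := inverseP Ye_cont Ye_lt.

Let Ye_lo M : exists x, Ye c m x <= M.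
Proof.
exists (- (m + `|M|)); rewrite YeN; last by rewrite oppr_le0 addr_ge0// ltW.
by rewrite opprD addrA subrr sub0r lerNl; rewrite -normrN ler_norm.
Qed.

Let Ye_hi M : exists x, M <= Ye c m x.
Proof.
have h : 0 <= `|M| / m by rewrite divr_ge0// ltW.
exists (`|M| / m); rewrite YeP//.
apply: le_trans (height_ge c0 m0 _).
apply: (@le_trans _ _ (m * (`|M| / m))); first by rewrite mulrC divfK ?gt_eqF// ler_norm.
by rewrite ler_pM2l// ltW// -[X in X < _]ger0_norm// slope_norm_gtnorm.
Qed.

(** The nonnegative inverse of the height profile, continued by 0 below m to be continuous on the
    whole line. *)
Definition slope_of_height y : R := locked (pos (inverse (Ye c m) y)).
Local Notation q := slope_of_height.

Lemma slope_of_height_ge0 y : 0 <= q y. Proof. by rewrite /q -lock pos_ge0. Qed.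

Lemma slope_of_height_continuous : continuous q.
Proof.
have [_ _ h _ _] := Ye_inv Ye_lo Ye_hi.
have -> : q = fun y => pos (inverse (Ye c m) y) by apply/funext => y; rewrite /q -lock.
by move=> y; apply: (@continuous_comp _ _ _ (inverse (Ye c m)) pos); [exact: h|exact: pos_continuous].
Qed.

Lemma slope_of_heightK p : 0 <= p -> q (Y c m p) = p.
Proof.
have [_ h _ _ _] := Ye_inv Ye_lo Ye_hi.
by move=> p0; rewrite /q -lock -YeP// h posP.
Qed.

Lemma slope_of_height_lem y : y <= m -> q y = 0.
Proof.
have [h _ _ _ _] := Ye_inv Ye_lo Ye_hi.
move=> ym; rewrite /q -lock posN// leNgt; apply/negP => i0.
have := Ye_lt i0; rewrite h YeP// height0//.
by rewrite ltNge ym.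
Qed.

Lemma slope_of_height_m : q m = 0. Proof. exact: slope_of_height_lem. Qed.

Lemma height_q y : m <= y -> Y c m (q y) = y.
Proof.
have [h _ _ hl _] := Ye_inv Ye_lo Ye_hi.
move=> my; have i0 : 0 <= inverse (Ye c m) y.
  rewrite leNgt; apply/negP => i0.
  by have := Ye_lt i0; rewrite h YeP// height0// ltNge my.
by rewrite /q -lock posP// -YeP// h.
Qed.

Lemma slope_of_height_le y1 y2 : y1 <= y2 -> q y1 <= q y2.
Proof.
move=> y12; have [y1m|my1] := leP y1 m; first by rewrite (slope_of_height_lem y1m) slope_of_height_ge0.
rewrite leNgt; apply/negP => /(height_lt c0 m0 (slope_of_height_ge0 _)).
by rewrite !height_q// ?(le_trans (ltW my1))// ?ltW// ltNge y12.
Qed.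

Lemma slope_of_height_gt0 y : m < y -> 0 < q y.
Proof.
move=> my; rewrite lt_neqAle slope_of_height_ge0 andbT; apply/eqP => q0.
by have := height_q (ltW my); rewrite -q0 height0// => e; rewrite e ltxx in my.
Qed.

(** The derivative p V(p) of the profile vanishes at p = 0, so the inverse is differentiated above m
    only. *)
Lemma der_slope_of_height y : m < y -> is_derive y 1 q (q y * V c m (q y))^-1.
Proof.
move=> my; have [h _ _ _ hd] := Ye_inv Ye_lo Ye_hi.
have q0 := slope_of_height_gt0 my.
have iq : inverse (Ye c m) y = q y.
  rewrite /q -lock posP// leNgt; apply/negP => i0.
  by have := Ye_lt i0; rewrite h YeP// height0// ltNge (ltW my).
have d1 : is_derive (q y) 1 (Ye c m) (q y * V c m (q y)).
  apply: near_eq_is_derive (der_height c0 m0 (q y)); near=> p.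
  by rewrite YeP// ltW//; near: p; exact: lt_nbhsr.
have := hd _ _ d1; rewrite YeP ?ltW// height_q ?ltW//.
have l0 : q y * V c m (q y) != 0 by rewrite mulf_neq0 ?gt_eqF// speed_gt0.
move=> /(_ l0); apply: near_eq_is_derive.
have [_ _ hc _ _] := Ye_inv Ye_lo Ye_hi.
have /cvgrPdist_lt/(_ _ q0) := hc y; rewrite iq.
apply: filterS => t; rewrite /q ltr_distlC subrr => /andP[t0 _].
by rewrite -lock posP// ltW.
Unshelve. all: by end_near. Qed.

(** The height [Y (q y)] is y above m and m below it. The field is thus 0 below m, and it is
    continuous and nonnegative everywhere. *)
Definition field_slope y : R := lagr_p c (Y c m (q y)) (q y).
Local Notation W := field_slope.

Let lp p := lagr_p c (Y c m p) p.
Let lp_continuous : continuous lp.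
Proof.
move=> p; have y0 := height_gt0 c0 m0 p.
notypeclasses refine (@der_continuous _ lp p _ _); rewrite /lp /lagr_p.
by der; [exact: der_height|exact: slope_norm_neq0|exact: der_slope_norm|rewrite gt_eqF|exact: der_height|
  exact/expf_neq0/slope_norm_neq0|exact: der_slope_norm].
Qed.

Lemma field_slope_continuous : continuous W.
Proof.
by move=> y; apply: (@continuous_comp _ _ _ q lp); [exact: slope_of_height_continuous|exact: lp_continuous].
Qed.

Lemma lagr_p_ge0 y p : 0 <= y -> 0 <= p -> 0 <= lagr_p c y p.
Proof.
move=> y0 p0; have s0 := ltW (slope_norm_gt0 p).
have h : 0 <= 2 + p ^+ 2 by rewrite addr_ge0// sqr_ge0.
rewrite /lagr_p; apply: addr_ge0; first by rewrite mulr_ge0 ?divr_ge0.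
by rewrite mulr_ge0 ?divr_ge0// ?mulr_ge0// exprn_ge0.
Qed.

Lemma field_slope_ge0 y : 0 <= W y.
Proof. by apply: lagr_p_ge0; rewrite ?slope_of_height_ge0// ltW// height_gt0. Qed.

Lemma field_slope_height p : 0 <= p -> W (Y c m p) = lagr_p c (Y c m p) p.
Proof. by move=> p0; rewrite /W slope_of_heightK. Qed.

(** The calibration inequality: the Weierstrass excess is nonnegative for every trial slope z, of
    either sign. *)
Lemma field_slope_le y z : m <= y -> z * W y <= lagr c y z - m.
Proof.
by move=> my; rewrite -subr_ge0; have := excess_ge0 c0 m0 (q y) z; rewrite /W height_q.
Qed.

Lemma field_slope_eq y z : m <= y -> z * W y = lagr c y z - m -> z = q y.
Proof.
move=> my /eqP; rewrite eq_sym -subr_eq0 => /eqP e.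
by apply: (excess_eq0 c0 m0); rewrite -e /W height_q.
Qed.

Lemma field_slope_eq_q y : m <= y -> q y * W y = lagr c y (q y) - m.
Proof. by move=> my; have := excess_self c0 m0 (q y); rewrite /W height_q. Qed.

Definition action := primitive m W.
Local Notation A := action.

Lemma der_action y : is_derive y 1 A (W y).
Proof. by have [+ _] := primitiveP m field_slope_continuous; apply. Qed.

Lemma action_m : A m = 0.
Proof. by have [] := primitiveP m field_slope_continuous. Qed.

Lemma action_le y1 y2 : y1 <= y2 -> A y1 <= A y2.
Proof.
move=> y12; apply: (der_le y12 (fun x _ => der_action x)); last by move=> x _; exact: field_slope_ge0.
by apply: continuous_subspaceT; exact: der_cont der_action.
Qed.

Lemma action_ge0 y : m <= y -> 0 <= A y.
Proof. by move=> /action_le; rewrite action_m. Qed.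

(** In the parameter p this derivative is also available at the turning point p = 0. *)
Lemma der_action_height p : 0 <= p ->
  is_derive p 1 (fun p => A (Y c m p)) ((lagr c (Y c m p) p - m) * V c m p).
Proof.
move=> p0; apply: (der_eq (derC (der_action _) (der_height c0 m0 p))).
by rewrite field_slope_height// excess_self// mulrA [_ * p]mulrC.
Qed.

(* With z = sqrt (y - m) as trial slope, field_slope_le gives W = O(sqrt (y - m)) near
   m. *)
Lemma action_small y r : m < y <= r ->
  A y <= (y - m) * (Num.sqrt (y - m) * (1 + r / 2 + c / m)).
Proof.
move=> /andP[my yr]; set e := y - m; have e0 : 0 < e by rewrite subr_gt0.
set z := Num.sqrt e; have z0 : 0 < z by rewrite sqrtr_gt0.
have zz : z ^+ 2 = e by rewrite sqr_sqrtr// ltW.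
have [x /andP[mx xy] Ax] := MVT_le der_action (ltW my).
rewrite action_m subr0 in Ax; rewrite Ax mulrC ler_pM2l//.
have x0 : 0 < x by exact: lt_le_trans mx.
rewrite -(ler_pM2l z0) mulrA -expr2 zz; apply: (le_trans (field_slope_le z mx)).
have S1 : S z <= 1 + e / 2.
  have h : 0 <= 1 + e / 2 by rewrite addr_ge0 ?divr_ge0// ltW.
  rewrite -ler_sqr ?nnegrE ?(ltW (slope_norm_gt0 z))// slope_norm_sqr zz; nra.
have h1 : x * S z <= x + r / 2 * e.
  apply: (@le_trans _ _ (x * (1 + e / 2))); first by rewrite ler_pM2l.
  rewrite mulrDr mulr1 lerD2l [r / 2 * e]mulrAC mulrCA mulrA ler_pM2r//.
  by rewrite mulrC ler_pM2r// (le_trans xy).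
have h2 : c * (z ^+ 2 / (x * S z)) <= c / m * e.
  rewrite zz -mulrA ler_wpM2l// [m^-1 * e]mulrC ler_pM2l//.
  rewrite lef_pV2 ?posrE ?mulr_gt0 ?slope_norm_gt0//.
  by apply: (le_trans mx); rewrite ler_pMr// slope_norm_ge1.
rewrite /lagr; have : x - m <= e by rewrite lerD2r.
lra.
Qed.

(** The climbing time from m to y, that is, the integral of 1 / q; defining it through the position
    avoids the singularity of 1 / q at m. *)
Definition time y := X c m (q y).
Local Notation tau := time.

Lemma time_m : tau m = 0. Proof. by rewrite /tau slope_of_height_m abscissa0. Qed.

Lemma time_continuous : continuous tau.
Proof.
move=> y; apply: (@continuous_comp _ _ _ q (X c m)); first exact: slope_of_height_continuous.
exact: abscissa_continuous.
Qed.

Lemma time_le y1 y2 : y1 <= y2 -> tau y1 <= tau y2.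
Proof.
move=> /slope_of_height_le; rewrite le_eqVlt => /predU1P[e|/(abscissa_lt c0 m0)/ltW//].
by rewrite /tau e.
Qed.

Lemma der_time y : m < y -> is_derive y 1 tau (q y)^-1.
Proof.
move=> my; apply: (der_eq (derC (der_abscissa c0 m0 (q y)) (der_slope_of_height my))).
have v0 := speed_gt0 c0 m0 (q y); have q0 := slope_of_height_gt0 my.
by field; rewrite !gt_eqF.
Qed.

(** By the mean value theorem the time is a value of V times q(y); the first is bounded by
    [speed_ub], and q(y) <= y / m because m S(q(y)) <= y. *)
Lemma time_ub y : m <= y -> tau y <= (m + 2 * c / m) * (y / m).
Proof.
move=> my.
have [x _] := MVT_le (der_abscissa c0 m0) (slope_of_height_ge0 y).
rewrite abscissa0// !subr0 -/(tau y) => ->.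
apply: ler_pM; rewrite ?slope_of_height_ge0 ?(ltW (speed_gt0 c0 m0 _))// ?speed_ub//.
rewrite ler_pdivlMr// mulrC -{2}(height_q my).
apply: le_trans (height_ge c0 m0 _).
by rewrite ler_pM2l// ltW// -{1}(ger0_norm (slope_of_height_ge0 y)) slope_norm_gtnorm.
Qed.

End Fixed.

Local Notation q := slope_of_height.
Local Notation W := field_slope.
Local Notation A := action.
Local Notation tau := time.

(** * Dependence of the reduced energy on the minimum *)

Section Compare.
Variables (c : R) (c0 : 0 <= c).

(* Along the extremal with minimum m, field_slope_le for m' bounds the derivative of
   A_m'. *)
Lemma compare m m' p1 p2 : 0 < m -> 0 < m' -> 0 <= p1 -> p1 <= p2 -> m' <= Y c m p1 ->
  A c m (Y c m p1) - A c m' (Y c m p1) - (m' - m) * X c m p1 <=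
  A c m (Y c m p2) - A c m' (Y c m p2) - (m' - m) * X c m p2.
Proof.
move=> m0 m'0 p10 p12 mY.
pose D p := A c m (Y c m p) - A c m' (Y c m p) - (m' - m) * X c m p.
have dD p : 0 <= p -> is_derive p 1 D
   ((lagr c (Y c m p) p - m) * V c m p - W c m' (Y c m p) * (p * V c m p) - (m' - m) * V c m p).
  move=> p0; rewrite /D; deriv; [exact: der_action_height|
    exact: (derC (der_action c0 m'0 _) (der_height c0 m0 p))|exact: der_abscissa|].
  by rewrite mul0r add0r.
apply: (der_le p12 (f := D)).
- by move=> p /andP[p1p _]; apply: dD; rewrite (le_trans p10)// ltW.
- apply/within_continuousE => p; rewrite in_itv/= => /andP[p1p _] e e0.
  have /cvgrPdist_lt/(_ _ e0)[d /= d0 H] := der_continuous (dD p (le_trans p10 p1p)).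
  by exists d => // y _ yx; rewrite distrC; apply: H => /=; rewrite distrC.
- move=> p /andP[p1p _].
  have h : m' <= Y c m p by apply: (le_trans mY); apply: height_le => //; exact: ltW.
  have := field_slope_le c0 m'0 p h; have := speed_gt0 c0 m0 p.
  move: (W _ _ _) (lagr _ _ _) (V _ _ _) => w l v v0 wl.
  have -> : (l - m) * v - w * (p * v) - (m' - m) * v = v * (l - m' - p * w) by ring.
  by rewrite mulr_ge0 ?(ltW v0)// subr_ge0.
Qed.

Variables (h r : R) (h0 : 0 < h).

Definition reduced_energy m : R := 2 * h * m + 2 * A c m r.
Local Notation Phi := reduced_energy.

(** [compare] along the extremal with minimum m1, between the heights m2 and r where the field of m2
    lives. The action of m2 vanishes at m2, and the nonnegative action of m1 there is dropped. *)
Lemma Phi_up m1 m2 : 0 < m1 -> m1 < m2 -> m2 <= r ->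
  Phi m2 - Phi m1 <= 2 * (m2 - m1) * (h - (tau c m1 r - tau c m1 m2)).
Proof.
move=> m10 m12 m2r; have m20 := lt_trans m10 m12.
have m1r := le_trans (ltW m12) m2r.
have := @compare m1 m2 (q c m1 m2) (q c m1 r) m10 m20 (slope_of_height_ge0 _ _ _) (slope_of_height_le c0 m10 m2r).
rewrite !height_q ?(ltW m12)// lexx => /(_ isT).
rewrite (action_m c0 m20) -!/(tau _ _ _).
have := action_ge0 c0 m10 (ltW m12).
by rewrite /Phi; nra.
Qed.

(** [compare] along the extremal with minimum m2, starting at its turning point. The action of m1 at
    height m2 remains, and [action_small] makes it of order (m2 - m1)^(3/2). *)
Lemma Phi_down m1 m2 : 0 < m1 -> m1 < m2 -> m2 <= r ->
  Phi m1 - Phi m2 <= 2 * (m2 - m1) * (tau c m2 r - h) +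
    2 * ((m2 - m1) * (Num.sqrt (m2 - m1) * (1 + r / 2 + c / m1))).
Proof.
move=> m10 m12 m2r; have m20 := lt_trans m10 m12.
have := @compare m2 m1 0 (q c m2 r) m20 m10 (lexx _) (slope_of_height_ge0 _ _ _).
rewrite height0// height_q// (ltW m12) => /(_ isT).
rewrite (action_m c0 m20) abscissa0// -!/(tau _ _ _).
have : A c m1 m2 <= _ := action_small c0 m10 (r := r) (introT andP (conj m12 m2r)).
set B := (_ * (Num.sqrt _ * _)).
by rewrite /Phi; nra.
Qed.

Lemma Phi_stationary m : 0 < m <= r ->
  (forall m', 0 < m' <= r -> Phi m <= Phi m') -> tau c m r = h.
Proof.
move=> /andP[m0 mr] mmin; apply/eqP; rewrite eq_le; apply/andP; split; rewrite leNgt; apply/negP => Th.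
(* If the climb takes longer than h, raising the minimum lowers Phi. There is room to raise it, as
   the time is 0 when m = r, and m2 is so close to m that [tau c m m2] stays below the gap. *)
- have mr' : m < r.
    rewrite lt_neqAle mr andbT; apply/eqP => e; move: Th.
    by rewrite -e time_m// ltNge (ltW h0).
  have T0 : 0 < tau c m r - h by rewrite subr_gt0.
  have /cvgrPdist_lt/(_ _ T0)[d /= d0 D] := @time_continuous c m c0 m0 m.
  pose m2 := Num.min r (m + d / 2).
  have mm2 : m < m2 by rewrite lt_min mr' ltrDl divr_gt0.
  have m2r : m2 <= r by rewrite ge_min lexx.
  have : `|tau c m m - tau c m m2| < tau c m r - h.
    apply: D => /=; rewrite distrC gtr0_norm ?subr_gt0// ltrBlDl.
    by rewrite gt_min ltrD2l ltr_pdivrMr// ltr_pMr// ltr1n orbT.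
  rewrite time_m// sub0r normrN => /ltr_normlW tm2.
  have := Phi_up m0 mm2 m2r; have := mmin m2.
  rewrite m2r (lt_trans m0 mm2) => /(_ isT) le1 le2.
  have : 2 * (m2 - m) * (h - (tau c m r - tau c m m2)) < 0.
    by rewrite pmulr_rlt0 ?mulr_gt0 ?subr_gt0//; lra.
  by lra.
(* If the climb is shorter than h, lowering the minimum by e lowers Phi. With e <= m / 2 the factor
   in [Phi_down] is at most K, and e <= s^2 makes the error at most half of the gain. *)
- set K := 1 + r / 2 + c / (m / 2).
  have K0 : 0 < K.
    have r0 := lt_le_trans m0 mr.
    have h1 : 0 <= r / 2 by rewrite divr_ge0// ltW.
    have h2 : 0 <= c / (m / 2) by rewrite divr_ge0// divr_ge0// ltW.
    by rewrite /K; lra.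
  pose s := (h - tau c m r) / (2 * K).
  have s0 : 0 < s by rewrite divr_gt0 ?mulr_gt0// subr_gt0.
  pose e := Num.min (m / 2) (s ^+ 2).
  have e0 : 0 < e by rewrite lt_min divr_gt0//= exprn_gt0.
  have em : e <= m / 2 by rewrite ge_min lexx.
  have es : Num.sqrt e <= s.
    by rewrite -[leRHS]gtr0_norm// -sqrtr_sqr ler_sqrt ?sqr_ge0// ge_min lexx orbT.
  have m10 : 0 < m - e by lra.
  have m1m : m - e < m by rewrite gtrBl.
  have := Phi_down m10 m1m mr; have := mmin (m - e).
  rewrite m10 (le_trans (ltW m1m))// => /(_ isT) le1.
  rewrite (_ : m - (m - e) = e); last by ring.
  have : Num.sqrt e * (1 + r / 2 + c / (m - e)) <= s * K.
    apply: ler_pM => //.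
      have r0 := lt_le_trans m0 mr.
      have h1 : 0 <= r / 2 by rewrite divr_ge0// ltW.
      have h2 : 0 <= c / (m - e) by rewrite divr_ge0// ltW.
      by move: h1 h2; lra.
    rewrite lerD2l ler_wpM2l// lef_pV2 ?posrE//; last by rewrite divr_gt0.
    by lra.
  have -> : s * K = (h - tau c m r) / 2 by rewrite /s; field; rewrite gt_eqF.
  by move=> le2 le3; nra.
Qed.

(* For small heights the slope is at most sqrt (2 / c) * y, so climbing away from 0
   takes a logarithmically divergent time. *)
Lemma slope_of_height_log_bound m y : 0 < c -> 0 < m -> m <= y -> y ^+ 2 <= c / 2 ->
  q c m y <= Num.sqrt (2 / c) * y.
Proof.
move=> cp m0 my yc; have y0 := lt_le_trans m0 my.
have k0 : 0 < Num.sqrt (2 / c) by rewrite sqrtr_gt0 divr_gt0.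
rewrite -ler_sqr ?nnegrE ?slope_of_height_ge0// ?mulr_ge0 ?(ltW k0) ?(ltW y0)//.
have kk := sqr_sqrtr (ltW (divr_gt0 (ltr0Sn R 1) cp)).
rewrite exprMn kk.
have := first_integral c0 m0 (q c m y); rewrite height_q//.
set p := q c m y; have := slope_norm_gt0 p; have := slope_norm_sqr p; set s := S p => ss s0 me.
have : 0 < m * (y * s ^+ 3) by rewrite !mulr_gt0 ?exprn_gt0.
have -> : m * (y * s ^+ 3) = y ^+ 2 * s ^+ 2 - c * p ^+ 2.
  by rewrite {1}me; field; rewrite !gt_eqF.
rewrite ss => cpy; rewrite mulrAC ler_pdivlMr//.
have := ler_wpM2l (sqr_ge0 p) yc.
by lra.
Qed.

Lemma Phi_min : 0 < c -> 0 < r ->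
  exists2 m, 0 < m <= r & forall m', 0 < m' <= r -> Phi m <= Phi m'.
Proof.
move=> cp r0; set k := Num.sqrt (2 / c).
have k0 : 0 < k by rewrite sqrtr_gt0 divr_gt0.
pose y1 := Num.min r (Num.sqrt (c / 2)).
have y10 : 0 < y1 by rewrite lt_min r0 sqrtr_gt0 divr_gt0.
have y1r : y1 <= r by rewrite ge_min lexx.
have y1c : y1 ^+ 2 <= c / 2.
  rewrite -(@sqr_sqrtr _ (c / 2)) ?divr_ge0//.
  by rewrite ler_sqr ?nnegrE ?sqrtr_ge0 ?(ltW y10)// ge_min lexx orbT.
(* By the logarithmic bound, climbing from [dl] to [y1] takes at least ln (y1 / dl) / k = h, so by
   [Phi_up] no minimum below [dl] does better than [dl]. *)
pose dl := y1 * expR (- (k * h)).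
have dl0 : 0 < dl by rewrite mulr_gt0// expR_gt0.
have dly : dl < y1.
  by rewrite /dl gtr_pMr// expR_lt1// oppr_lt0 mulr_gt0.
have dlr : dl <= r by rewrite (le_trans (ltW dly)).
have small m1 : 0 < m1 < dl -> Phi dl <= Phi m1.
  move=> /andP[m10 m1d]; rewrite -subr_le0; apply: (le_trans (Phi_up m10 m1d dlr)).
  rewrite pmulr_rle0 ?mulr_gt0 ?subr_gt0// subr_le0.
  apply: (@le_trans _ _ (tau c m1 y1 - tau c m1 dl)); last first.
    by rewrite lerD2r; exact: time_le.
  have : tau c m1 dl - k^-1 * ln dl <= tau c m1 y1 - k^-1 * ln y1.
    have dt y : 0 < y -> m1 < y -> is_derive y 1 (fun y => tau c m1 y - k^-1 * ln y)
        ((q c m1 y)^-1 - k^-1 / y).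
      move=> y0 my; deriv; [exact: der_time|exact: y0|].
      by field; rewrite !gt_eqF// slope_of_height_gt0.
    apply: (der_le (ltW dly) (f := fun y => tau c m1 y - k^-1 * ln y)).
    + by move=> y /andP[dy _]; apply: dt; [exact: lt_trans dy|exact: lt_trans dy].
    + apply/within_continuousE => y; rewrite in_itv/= => /andP[dy _] e e0.
      have /cvgrPdist_lt/(_ _ e0)[d /= d0 H] := der_continuous (dt y (lt_le_trans dl0 dy) (lt_le_trans m1d dy)).
      by exists d => // t _ ty; rewrite distrC; apply: H => /=; rewrite distrC.
    + move=> y /andP[dy yy1]; have my := lt_trans m1d dy; have y0 := lt_trans dl0 dy.
      rewrite subr_ge0 -invfM lef_pV2 ?posrE ?slope_of_height_gt0 ?mulr_gt0//.
      apply: slope_of_height_log_bound => //; first exact: ltW.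
      by apply: le_trans y1c; rewrite ler_sqr ?nnegrE ?(ltW y10) ?(ltW y0)// ltW.
  have -> : ln dl = ln y1 - k * h.
    by rewrite /dl lnM ?posrE ?expR_gt0// expRK.
  have -> : k^-1 * (ln y1 - k * h) = k^-1 * ln y1 - h by field; rewrite gt_eqF.
  by lra.
(* A crude Lipschitz constant for Phi on [[dl, r]], collecting the bounds of [Phi_up] and
   [Phi_down]; it gives the continuity needed for a minimum. *)
pose L := 2 * h + 2 * ((r + 2 * c / dl) * (r / dl)) + 2 * ((1 + r) * (1 + r / 2 + c / dl)) + 1.
have q1 : 0 <= (r + 2 * c / dl) * (r / dl).
  by rewrite mulr_ge0 ?addr_ge0 ?divr_ge0 ?mulr_ge0// ltW.
have q2 : 0 <= (1 + r) * (1 + r / 2 + c / dl).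
  by rewrite mulr_ge0 ?addr_ge0 ?divr_ge0// ltW.
have L0 : 0 < L by rewrite /L; move: q1 q2 h0; lra.
have Lip m1 m2 : dl <= m1 -> m1 < m2 -> m2 <= r -> `|Phi m2 - Phi m1| <= L * (m2 - m1).
  move=> dm1 m12 m2r; have m10 := lt_le_trans dl0 dm1; have m20 := lt_trans m10 m12.
  have e0 : 0 < m2 - m1 by rewrite subr_gt0.
  rewrite ler_norml; apply/andP; split.
    rewrite lerNl opprB; apply: (le_trans (Phi_down m10 m12 m2r)).
    have h1 : tau c m2 r <= (r + 2 * c / dl) * (r / dl).
      apply: (le_trans (time_ub c0 m20 m2r)).
      apply: ler_pM; rewrite ?addr_ge0 ?divr_ge0 ?mulr_ge0 ?(ltW m20) ?(ltW r0)//.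
        apply: lerD => //; rewrite ler_wpM2l ?mulr_ge0// lef_pV2 ?posrE//.
        by rewrite (le_trans dm1)// ltW.
      by rewrite ler_wpM2l ?(ltW r0)// lef_pV2 ?posrE// (le_trans dm1)// ltW.
    have h2 : Num.sqrt (m2 - m1) * (1 + r / 2 + c / m1) <= (1 + r) * (1 + r / 2 + c / dl).
      apply: ler_pM; rewrite ?sqrtr_ge0 ?addr_ge0 ?divr_ge0 ?(ltW m10) ?(ltW r0)//.
        have s2 := sqr_sqrtr (ltW e0); have s0 := sqrtr_ge0 (m2 - m1).
        by move: (Num.sqrt _) s2 s0 => s s2 s0; nra.
      by rewrite lerD2l ler_wpM2l// lef_pV2 ?posrE.
    rewrite -subr_ge0; set B := Num.sqrt _ * _ in h2 *; set T := tau _ _ _ in h1 *.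
    rewrite [X in 0 <= X](_ : _ = (m2 - m1) * (L - 2 * (T - h) - 2 * B)); last by ring.
    by apply: mulr_ge0; [exact: ltW|rewrite /L; move: h1 h2 q1 q2 h0; lra].
  apply: (le_trans (Phi_up m10 m12 m2r)).
  have h1 : tau c m1 m2 <= tau c m1 r by exact: time_le.
  rewrite -subr_ge0 [X in 0 <= X](_ : _ = (m2 - m1) *
    (L - 2 * (h - (tau c m1 r - tau c m1 m2)))); last by ring.
  by apply: mulr_ge0; [exact: ltW|rewrite /L; move: h1 q1 q2; lra].
have cPhi : {within `[dl, r], continuous Phi}.
  apply/within_continuousE => x; rewrite in_itv/= => /andP[dx xr] e e0.
  exists (e / L); first by rewrite divr_gt0.
  move=> y; rewrite in_itv/= => /andP[dy yr] yx.
  have : L * `|y - x| < e by rewrite mulrC -ltr_pdivlMr.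
  apply: le_lt_trans.
  have [xy|yx'|->] := ltgtP x y; last by rewrite !subrr normr0 mulr0.
  - by rewrite [leRHS](_ : _ = L * (y - x)) ?Lip// gtr0_norm// subr_gt0.
  - by rewrite distrC [leRHS](_ : _ = L * (x - y)) ?Lip// distrC gtr0_norm// subr_gt0.
have [m] := EVT_min dlr cPhi; rewrite in_itv/= => /andP[dm mr] Hm.
exists m; first by rewrite mr (lt_le_trans dl0).
move=> m' /andP[m'0 m'r]; have [dm'|m'd] := leP dl m'.
  by apply: Hm; rewrite in_itv/= dm'.
apply: (le_trans (Hm dl _)); first by rewrite in_itv/= lexx.
by apply: small; rewrite m'0.
Qed.

End Compare.
End Calibration.

(** * The energy identity *)

Section Energy.
Variable R : realType.
Notation mu := (@lebesgue_measure R).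
Implicit Types (a b c h m r x y : R) (g rho : R -> R).
Local Notation S := (@slope_norm R).
Local Notation Y := (@height R).
Local Notation Z := (@slope_at R).
Local Notation q := (@slope_of_height R).
Local Notation W := (@field_slope R).
Local Notation A := (@action R).
Local Notation tau := (@time R).

Definition area_density rho g x : R := rho x * S (g x).
Definition bend_density rho g x : R := g x ^+ 2 / (rho x * S (g x)).

Lemma lagr_area_bend c rho g x :
  lagr c (rho x) (g x) = area_density rho g x + c * bend_density rho g x.
Proof. by []. Qed.

Lemma area_density_ge0 rho g x : 0 < rho x -> 0 <= area_density rho g x.
Proof. by move=> r0; rewrite mulr_ge0// ltW// slope_norm_gt0. Qed.

Lemma bend_density_ge0 rho g x : 0 < rho x -> 0 <= bend_density rho g x.
Proof. by move=> r0; rewrite divr_ge0 ?sqr_ge0// mulr_ge0// ltW// slope_norm_gt0. Qed.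

Section AdmissibleDensity.
Variables (a b : R) (rho g : R -> R).
Hypotheses (ab : a <= b) (dg : density a b rho g).
Hypothesis rho0 : forall x, x \in `[a, b] -> 0 < rho x.

Let crho := density_continuous ab dg.
Let gi : itg a b g := dg.1.

Let comp_meas (f : R -> R) : continuous f -> measurable_fun `[a, b] (fun x => f (g x)).
Proof.
move=> cf; apply: (measurableT_comp (continuous_measurable_fun cf)); exact: itg_meas.
Qed.

Lemma itg_area : itg a b (area_density rho g).
Proof.
apply: itg_mull crho _; apply: (@le_norm_itg _ a b (fun x => S (g x)) g) => //.
  by apply: comp_meas; exact: slope_norm_continuous.
by move=> x; rewrite ger0_norm ?slope_norm_le// ltW// slope_norm_gt0.
Qed.

Lemma itg_bend : itg a b (bend_density rho g).
Proof.
(* Since |p| < S(p), Q(p) is dominated by |p|, hence is integrable along g. *)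
pose Q p : R := p ^+ 2 / S p.
have cQ : continuous Q.
  move=> p; notypeclasses refine (@der_continuous _ Q p _ _); rewrite /Q.
  by der; [exact: slope_norm_neq0|exact: der_slope_norm].
have iQ : itg a b (fun x => Q (g x)).
  apply: (@le_norm_itg _ a b (fun x => Q (g x)) g) => //; first exact: comp_meas.
  move=> x; have s0 := slope_norm_gt0 (g x); have sg := slope_norm_gtnorm (g x).
  rewrite ger0_norm ?divr_ge0 ?sqr_ge0 ?(ltW s0)// ler_pdivrMr//.
  rewrite -real_normK ?num_real//; have := normr_ge0 (g x); nra.
have cI : {within `[a, b], continuous (fun x => (rho x)^-1)}.
  apply: (@within_continuous_comp _ _ _ _ rho (fun y => y^-1)) crho => _ /set_mem [x xab <-].
  by have := @der_continuous _ _ (rho x) _ (derV (lt0r_neq0 (rho0 xab)) (der_id _)).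
have := itg_mull cI iQ.
rewrite (_ : (fun x => (rho x)^-1 * Q (g x)) = bend_density rho g)//.
by apply/funext => x; rewrite /Q /bend_density invfM mulrCA.
Qed.

Lemma itg_lagr c : itg a b (fun x => lagr c (rho x) (g x)).
Proof. by apply: itgD; [exact: itg_area|apply: itgZ; exact: itg_bend]. Qed.

Lemma int_lagr c : \int[mu]_(x in `[a, b]) lagr c (rho x) (g x) =
  \int[mu]_(x in `[a, b]) area_density rho g x +
  c * \int[mu]_(x in `[a, b]) bend_density rho g x.
Proof.
rewrite -RintegralZl//; last exact: itg_bend.
by rewrite -RintegralD//; [exact: itg_area|apply: itgZ; exact: itg_bend].
Qed.

End AdmissibleDensity.

(** [derive1 rho] agrees with g off a null set, to which the two end points are added because
    [density_ae] covers the open interval only. *)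
Lemma Ec_density h c rho g : 0 < h -> 0 <= c -> density (- h) h rho g ->
  (forall x, x \in `[- h, h] -> 0 < rho x) ->
  Ec h c rho = (\int[mu]_(x in `[- h, h]) lagr c (rho x) (g x))%:E.
Proof.
move=> h0 c0 dg r0; have hh : - h <= h by rewrite ge0_cp// ltW.
have li := itg_lagr hh dg r0 c.
rewrite /Rintegral fineK; last exact: integrable_fin_num.
have lge (x p : R) : x \in `[- h, h] -> 0 <= lagr c (rho x) p.
  move=> xh; have := @lagr_area_bend c rho (fun=> p) x => ->.
  apply: addr_ge0; first by apply: area_density_ge0; exact: r0.
  by apply: mulr_ge0 => //; apply: bend_density_ge0; exact: r0.
have [N [mN N0 sN]] := density_ae dg.
apply: (@ge0_ae_eq_integral_nonmeasurable _ _ _ mu _ (N `|` [set - h] `|` [set h])) => //.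
- by apply: measurableU => //; apply: measurableU.
- have Nh : mu (N `|` [set - h]) = 0%E.
    by rewrite measureU0 => [|//|//|]; [exact: N0|exact: lebesgue_measure_set1].
  rewrite measureU0 => [|||]; [exact: Nh|exact: measurableU|by []|exact: lebesgue_measure_set1].
- exact: measurable_int li.
- by move=> x xh; rewrite lee_fin; exact: lge.
- by move=> x xh; rewrite lee_fin; exact: lge.
move=> x; rewrite /= in_itv/= => /andP[hx xh] nx; congr (_%:E).
have /= xo : x \in `]- h, h[.
  rewrite in_itv/= !lt_neqAle hx xh !andbT; apply/andP; split; apply/eqP => e; apply: nx.
    by left; right.
  by right.
have -> : derive1 rho x = g x.
  apply: contrapT => ne; apply: nx; left; left; apply: sN => /= H.
  by apply: ne; apply: H.
by [].
Qed.

Section Identity.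
Variables (c m : R) (c0 : 0 <= c) (m0 : 0 < m).

Lemma lagr_even y z : lagr c y (- z) = lagr c y z.
Proof. by rewrite /lagr slope_norm_even sqrrN. Qed.

(** * The excess on one side of the minimum point *)

Section Half.
Variables (a b : R) (rho g : R -> R) (sg : R).
Hypotheses (ab : a <= b) (dg : density a b rho g).
Hypothesis rhom : forall x, x \in `[a, b] -> m <= rho x.
Hypothesis sg1 : sg = 1 \/ sg = -1.

(** The sign [sg] is -1 to the left of the minimum point, where an extremal descends through the
    field, and 1 to the right, where it climbs. *)
Definition excess x := lagr c (rho x) (g x) - m - sg * (W c m (rho x) * g x).

Let rho0 x : x \in `[a, b] -> 0 < rho x.
Proof. by move=> xab; exact: lt_le_trans (rhom xab). Qed.

Let lagr_sg y z : lagr c y (sg * z) = lagr c y z.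
Proof. by case: sg1 => ->; rewrite ?mul1r// mulN1r lagr_even. Qed.

Lemma excess_nonneg x : x \in `[a, b] -> 0 <= excess x.
Proof.
move=> xab; rewrite subr_ge0 mulrCA mulrC -[in leRHS]lagr_sg.
by apply: field_slope_le => //; exact: rhom.
Qed.

Let cW : {within `[a, b], continuous (fun x => W c m (rho x))}.
Proof.
apply: (@within_continuous_comp _ _ _ _ rho (W c m) _ (density_continuous ab dg)) => y _.
exact: field_slope_continuous.
Qed.

Lemma itg_excess : itg a b excess.
Proof.
apply: itgB; last by apply: itgZ; apply: itg_mull cW _; exact: dg.1.
by apply: itgB; [exact: itg_lagr|exact: itg_cst].
Qed.

Lemma int_excess : \int[mu]_(x in `[a, b]) lagr c (rho x) (g x) =
  m * (b - a) + sg * (A c m (rho b) - A c m (rho a)) + \int[mu]_(x in `[a, b]) excess x.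
Proof.
have li := itg_lagr ab dg rho0 c.
have Wi : itg a b (fun x => W c m (rho x) * g x) by apply: itg_mull cW _; exact: dg.1.
rewrite -(density_chain ab dg (der_action c0 m0) (field_slope_continuous c0 m0)).
have -> : \int[mu]_(x in `[a, b]) excess x = \int[mu]_(x in `[a, b]) lagr c (rho x) (g x) -
    \int[mu]_(x in `[a, b]) m - sg * \int[mu]_(x in `[a, b]) (W c m (rho x) * g x).
  rewrite -RintegralZl// -RintegralB//; last exact: itg_cst.
  by rewrite -RintegralB//; [apply: itgB => //; exact: itg_cst|exact: itgZ].
rewrite Rintegral_cst//.
have L : fine ((@lebesgue_measure R) `[a, b]%classic) = b - a.
  rewrite lebesgue_measure_itv/= lte_fin; move: ab; rewrite le_eqVlt => /predU1P[->|->].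
    by rewrite ltxx subrr.
  by rewrite -EFinD.
by rewrite [fine _]L; ring.
Qed.

Lemma excess_ae_slope : \int[mu]_(x in `[a, b]) excess x = 0 ->
  {ae mu, forall x, x \in `[a, b] -> g x = sg * q c m (rho x)}.
Proof.
move=> I0; have := Rint_ge0_eq0 itg_excess excess_nonneg I0.
apply: filterS; first exact: (ae_filter_ringOfSetsType mu).
move=> x H xab; have /eqP := H xab.
have e : sg * (W c m (rho x) * g x) = (sg * g x) * W c m (rho x) by ring.
rewrite subr_eq0 e -lagr_sg eq_sym => /eqP /(field_slope_eq c0 m0 (rhom xab)) <-.
by case: sg1 => ->; ring.
Qed.

End Half.

(** * The energy on the whole interval *)

Section Whole.
Variables (h r x0 : R) (rho g : R -> R).
Hypotheses (h0 : 0 < h) (dg : density (- h) h rho g).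
Hypothesis rhom : forall x, x \in `[- h, h] -> m <= rho x.
Hypotheses (rl : rho (- h) = r) (rr : rho h = r) (x0h : x0 \in `[- h, h]) (rx0 : rho x0 = m).

Let hx0 : - h <= x0. Proof. by move: x0h; rewrite in_itv/= => /andP[]. Qed.
Let x0h' : x0 <= h. Proof. by move: x0h; rewrite in_itv/= => /andP[]. Qed.

Lemma density_sub a b (rho' g' : R -> R) x y : density a b rho' g' -> a <= x -> x <= y -> y <= b ->
  density x y rho' g'.
Proof.
move=> d ax xy yb; split; first by apply: itgS d.1.
move=> t; rewrite in_itv/= => /andP[xt ty].
by rewrite (density_diff d)// ?subrKC// (le_trans ty).
Qed.

Let dl : density (- h) x0 rho g. Proof. exact: density_sub dg _ _ _. Qed.
Let dr : density x0 h rho g. Proof. exact: density_sub dg _ _ _. Qed.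
Let ml x : x \in `[- h, x0] -> m <= rho x.
Proof. by rewrite in_itv/= => /andP[? ?]; apply: rhom; rewrite in_itv/=; apply/andP; split => //; exact: le_trans x0h'. Qed.
Let mr x : x \in `[x0, h] -> m <= rho x.
Proof. by rewrite in_itv/= => /andP[? ?]; apply: rhom; rewrite in_itv/=; apply/andP; split => //; exact: le_trans hx0 _. Qed.
Let N1 : (-1 : R) = 1 \/ (-1 : R) = -1. Proof. by right. Qed.
Let P1 : (1 : R) = 1 \/ (1 : R) = -1. Proof. by left. Qed.

(** The interval is cut where rho attains m. There the action vanishes, so each half contributes the
    action at r. *)
Lemma energyE : \int[mu]_(x in `[- h, h]) lagr c (rho x) (g x) = reduced_energy c h r m +
  (\int[mu]_(x in `[- h, x0]) excess rho g (-1) x + \int[mu]_(x in `[x0, h]) excess rho g 1 x).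
Proof.
have rp x : x \in `[- h, h] -> 0 < rho x by move=> /rhom; exact: lt_le_trans.
have hh : - h <= h by rewrite ge0_cp// ltW.
rewrite (@Rint_cat _ (- h) x0 h); [|by rewrite hx0|exact: itg_lagr].
rewrite (int_excess (-1) hx0 dl ml) (int_excess 1 x0h' dr mr).
by rewrite rl rr rx0 (action_m c0 m0) /reduced_energy; ring.
Qed.

Let exl : 0 <= \int[mu]_(x in `[- h, x0]) excess rho g (-1) x.
Proof. by apply: Rintegral_ge0 => x xh; apply: (excess_nonneg g ml N1). Qed.
Let exr : 0 <= \int[mu]_(x in `[x0, h]) excess rho g 1 x.
Proof. by apply: Rintegral_ge0 => x xh; apply: (excess_nonneg g mr P1). Qed.

Lemma energy_ge : reduced_energy c h r m <= \int[mu]_(x in `[- h, h]) lagr c (rho x) (g x).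
Proof. by rewrite energyE lerDl addr_ge0. Qed.

Lemma energy_eq : \int[mu]_(x in `[- h, h]) lagr c (rho x) (g x) <= reduced_energy c h r m ->
  {ae mu, forall x, x \in `[- h, x0] -> g x = -1 * q c m (rho x)} /\
  {ae mu, forall x, x \in `[x0, h] -> g x = 1 * q c m (rho x)}.
Proof.
rewrite energyE gerDl => le0.
have [e1 e2] : \int[mu]_(x in `[- h, x0]) excess rho g (-1) x = 0 /\
  \int[mu]_(x in `[x0, h]) excess rho g 1 x = 0.
  by move: exl exr le0; move: (Rintegral _ _ _) (Rintegral _ _ _) => u v; split; lra.
by split; [exact: (excess_ae_slope hx0 dl ml N1)|exact: (excess_ae_slope x0h' dr mr P1)].
Qed.

End Whole.

(** A density that is almost everywhere equal to a continuous f can be replaced by f, so rho is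
    classically differentiable. *)
Lemma density_ae_derive a b rho g f : density a b rho g ->
  {within `[a, b], continuous f} -> {ae mu, forall x, x \in `[a, b] -> g x = f x} ->
  forall x, a < x < b -> is_derive x 1 rho (f x).
Proof.
move=> dg cf gf x /andP[ax xb].
have fi := continuous_itg cf.
have cfx : {for x, continuous f}.
  by apply: within_continuous_continuous cf _; [exact: lt_trans xb|rewrite in_itv/= ax].
have [d1 d2] := @continuous_FTC1_closed R f a x b xb fi ax cfx.
rewrite derive1E in d2.
have d3 := @DeriveDef _ _ _ _ _ _ _ d1 d2.
have d4 := derD (der_cst (rho a) x) d3; rewrite add0r in d4.
apply: near_eq_is_derive d4; near=> t.
have /andP[at_ tb] : a < t < b by apply/andP; split; near: t; [exact: lt_nbhsr|exact: lt_nbhsl].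
rewrite (dg.2 t) ?in_itv/= ?(ltW at_) ?(ltW tb)//; congr (_ + _).
rewrite /Rintegral; congr fine; apply: ae_eq_integral => //.
- by apply: measurable_int (itgS (lexx a) (ltW tb) fi).
- by apply: measurable_int (itgS (lexx a) (ltW tb) dg.1).
move: gf; apply: filterS; first exact: (ae_filter_ringOfSetsType mu).
move=> z H; rewrite /= in_itv/= => /andP[az zt]; rewrite H// in_itv/= az.
by rewrite (le_trans zt)// ltW.
Unshelve. all: by end_near. Qed.

(* The elapsed time along rho' = q (rho) is bounded by the abscissa; it is smaller
   exactly when rho stays at its minimum m. *)
Lemma ode_time a b rho : {within `[a, b], continuous rho} ->
  (forall x, x \in `[a, b] -> m <= rho x) ->
  (forall x, a < x < b -> is_derive x 1 rho (q c m (rho x))) ->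
  forall x y, a <= x -> x <= y -> y <= b ->
  tau c m (rho y) - tau c m (rho x) <= y - x.
Proof.
move=> cr rm dr x y ax xy yb.
(* While rho stays above m, the function tau (rho t) has derivative 1. *)
have MV s : x <= s -> s <= y -> (forall t, s < t < y -> m < rho t) ->
    tau c m (rho y) - tau c m (rho s) = y - s.
  move=> xs sy H; move: (sy); rewrite le_eqVlt => /predU1P[->|sy']; first by rewrite !subrr.
  have [||t _ ->] := @MVT_lt R (fun t => tau c m (rho t)) (fun=> 1) s y sy'; last by rewrite mul1r.
    move=> t /andP[st ty].
    have mt : m < rho t by apply: H; rewrite st.
    have dt : is_derive t 1 rho (q c m (rho t)).
      by apply: dr; rewrite (le_lt_trans (le_trans ax xs) st) (lt_le_trans ty).
    apply: (der_eq (derC (der_time c0 m0 mt) dt)).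
    by rewrite mulVf// gt_eqF// slope_of_height_gt0.
  apply: (@continuous_subspaceW _ _ `[s, y]%classic `[a, b]%classic (fun t => tau c m (rho t))).
    by apply: subset_itv; rewrite bnd_simp// (le_trans ax).
  apply: (@within_continuous_comp _ _ _ _ rho (tau c m)) cr => z _.
  exact: time_continuous.
have T0 z : m <= z -> 0 <= tau c m z.
  by move=> mz; rewrite -(time_m c0 m0); exact: time_le.
have rmx : m <= rho x by apply: rm; rewrite in_itv/= ax (le_trans xy).
have [rym|rym] := leP (rho y) m.
  have -> : rho y = m by apply/eqP; rewrite eq_le rym rm// in_itv/= yb (le_trans ax).
  by rewrite time_m// sub0r (@le_trans _ _ 0) ?oppr_le0 ?T0// subr_ge0.
(* After the last visit to m, elapsed and climbing time agree; whatever happened before can only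
   have wasted time. *)
pose E := [set t | x <= t <= y /\ rho t = m].
have [E0|/set0P[e Ee]] := eqVneq E set0.
  rewrite MV// => t /andP[xt ty]; rewrite lt_neqAle rm ?andbT; last first.
    by rewrite in_itv/= (le_trans ax (ltW xt)) (le_trans (ltW ty)).
  apply/eqP => et; suff : E t by rewrite E0.
  by split; rewrite // ?(ltW xt) ?(ltW ty).
have sE : has_sup E by split; [exists e|exists y => t [/andP[]]].
set s := sup E.
have xs : x <= s.
  by have [/andP[xe _] _] := Ee; apply: (le_trans xe); exact: sup_upper_bound.
have sy : s <= y by apply: ge_sup; [exists e|move=> t [/andP[]]].
have sab : s \in `[a, b] by rewrite in_itv/= (le_trans ax)//= (le_trans sy).
have rs : rho s = m.
  apply/eqP; rewrite eq_le rm// andbT leNgt; apply/negP => ms.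
  have d0 : 0 < rho s - m by rewrite subr_gt0.
  have /within_continuousE/(_ s sab _ d0)[d dp D] := cr.
  have [t [/andP[xt ty] rt] td] := sup_adherent dp sE.
  have ts : t <= s by apply: sup_upper_bound => //; split => //; rewrite xt.
  have : `|rho t - rho s| < rho s - m.
    apply: D; first by rewrite in_itv/= (le_trans ax)//= (le_trans ty).
    by rewrite distrC ger0_norm ?subr_ge0//; move: td; rewrite -/s; lra.
  by rewrite rt distrC gtr0_norm// ltxx.
have := MV s xs sy; rewrite rs time_m// subr0 => -> //; last first.
  move=> t /andP[st ty]; rewrite lt_neqAle rm ?andbT; last first.
    by rewrite in_itv/= (le_trans ax (le_trans xs (ltW st))) (le_trans (ltW ty)).
  apply/eqP => et; have : t <= s.
    by apply: sup_upper_bound => //; split; rewrite // (le_trans xs (ltW st)) ltW.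
  by rewrite leNgt st.
by move: (T0 _ rmx) xs; lra.
Qed.

End Identity.
End Energy.

(** * Minimizers are extremals *)

Section Minimizers.
Variable R : realType.
Notation mu := (@lebesgue_measure R).
Implicit Types (a b c h m r x y : R) (g rho : R -> R).
Local Notation S := (@slope_norm R).
Local Notation Y := (@height R).
Local Notation X := (@abscissa R).
Local Notation Z := (@slope_at R).
Local Notation q := (@slope_of_height R).
Local Notation W := (@field_slope R).
Local Notation A := (@action R).
Local Notation tau := (@time R).
Local Notation Phi := (@reduced_energy R).
Local Notation ext := (@extremal R).

Section Fixed.
Variables (h r c : R) (h0 : 0 < h) (r0 : 0 < r) (c0 : 0 <= c).

Let hh : - h <= h. Proof. by rewrite ge0_cp// ltW. Qed.

Lemma admissible_min rho : admissible h r rho ->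
  exists g m x0, [/\ density (- h) h rho g, 0 < m <= r, x0 \in `[- h, h], rho x0 = m &
    forall x, x \in `[- h, h] -> m <= rho x].
Proof.
move=> [W1 [rp [rl rr]]]; have [g dg] := W11_density W1.
have [x0 x0h Hx] := EVT_min hh (density_continuous hh dg).
exists g, (rho x0), x0; split => //.
by rewrite rp//= -rr Hx// in_itv/= hh lexx.
Qed.

Lemma Ec_ge rho : admissible h r rho ->
  exists2 m, 0 < m <= r & ((Phi c h r m)%:E <= Ec h c rho)%E.
Proof.
move=> ad; have [g [m [x0 [dg m0 x0h rx0 Hm]]]] := admissible_min ad.
have [_ [rp [rl rr]]] := ad; exists m => //.
rewrite (Ec_density h0 c0 dg rp) lee_fin.
by case/andP: m0 => m0 _; exact: (energy_ge c0 m0 h0 dg Hm rl rr x0h rx0).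
Qed.

Section Extremals.
Variables (m : R) (m0 : 0 < m) (mr : m <= r) (Tm : tau c m r = h).

Let ZX := slope_atP c0 m0.

Lemma slope_at_lt x y : x < y -> Z c m x < Z c m y.
Proof. by have [_ _ _ + _] := ZX; apply. Qed.

Lemma slope_at_h : Z c m h = q c m r.
Proof. by have [_ + _ _ _] := ZX; rewrite -Tm; apply. Qed.

Lemma ext_h : ext c m h = r.
Proof. by rewrite /extremal slope_at_h height_q. Qed.

Lemma slope_at_ge0 x : 0 <= x -> 0 <= Z c m x.
Proof. by rewrite le_eqVlt => /predU1P[<-|/slope_at_lt/ltW]; rewrite slope_at0. Qed.

Lemma ext_q x : 0 <= x -> q c m (ext c m x) = Z c m x.
Proof. by move=> x0; rewrite /extremal slope_of_heightK// slope_at_ge0. Qed.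

Lemma ext_ge x : m <= ext c m x.
Proof. exact: height_ge_m. Qed.

Lemma ext_density : density (- h) h (ext c m) (Z c m).
Proof.
by apply: primitive_density; [exact: der_extremal|have [_ _ + _ _] := ZX].
Qed.

Lemma ext_admissible : admissible h r (ext c m).
Proof.
split; first exact: density_W11 ext_density.
split; first by move=> x _; exact: height_gt0.
by rewrite extremal_even// ext_h.
Qed.

Lemma ext_energy : Ec h c (ext c m) = (Phi c h r m)%:E.
Proof.
rewrite (Ec_density h0 c0 ext_density); last by move=> x _; exact: height_gt0.
have z0 : 0 \in `[- h, h] by rewrite in_itv/= oppr_le0 ltW.
have el : ext c m (- h) = r by rewrite extremal_even// ext_h.
have eg x : x \in `[- h, h] -> m <= ext c m x by move=> _; exact: ext_ge.
congr (_%:E).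
rewrite (energyE c0 m0 h0 ext_density eg el ext_h z0 (extremal0 c0 m0)).
have ex0 x sg : q c m (ext c m x) = sg * Z c m x -> sg = 1 \/ sg = -1 ->
    excess c m (ext c m) (Z c m) sg x = 0.
  move=> e s1; rewrite /excess mulrCA mulrC -e field_slope_eq_q ?ext_ge// e.
  by case: s1 => ->; rewrite ?mul1r ?mulN1r ?lagr_even subrr.
have I0 a b (f : R -> R) : (forall x, x \in `[a, b] -> f x = 0) -> \int[mu]_(x in `[a, b]) f x = 0.
  move=> f0; transitivity (\int[mu]_(x in `[a, b]) (0 : R)); last by rewrite Rintegral_cst// mul0r.
  by apply: eq_Rintegral => x; rewrite inE; exact: f0.
rewrite (I0 (- h)); last first.
  move=> x; rewrite in_itv/= => /andP[xl xr]; apply: ex0; last by right.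
  by rewrite mulN1r -slope_at_odd// -ext_q ?oppr_ge0// extremal_even.
rewrite I0 ?addr0// => x; rewrite in_itv/= => /andP[xl xr]; apply: ex0; last by left.
by rewrite mul1r ext_q.
Qed.

End Extremals.

Definition Phi_minimal m := 0 < m <= r /\ forall m', 0 < m' <= r -> Phi c h r m <= Phi c h r m'.

Lemma Phi_minimal_minimizer m : Phi_minimal m -> minimizer h r c (ext c m).
Proof.
move=> [mr mmin]; have Tm := Phi_stationary c0 h0 mr mmin.
case/andP: (mr) => m0 mr'; split; first exact: ext_admissible.
move=> s /Ec_ge [m' m'r]; apply: le_trans.
by rewrite ext_energy// lee_fin mmin.
Qed.

(** The climb from m to r needs time h but has only h - x0 at its disposal, whence x0 <= 0. If x0 =
    0, no time is wasted: the bounds on [[0, x]] and [[x, h]] add up to an equality, so tau (rho x)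
    = x. *)
Lemma ode_unique m x0 rho : 0 < m -> tau c m r = h -> x0 <= h ->
  {within `[x0, h], continuous rho} -> (forall x, x \in `[x0, h] -> m <= rho x) ->
  rho h = r -> rho x0 = m ->
  (forall x, x0 < x < h -> is_derive x 1 rho (q c m (rho x))) ->
  x0 <= 0 /\ (x0 = 0 -> forall x, x \in `[0, h] -> rho x = ext c m x).
Proof.
move=> m0 Tm x0h crho rm rr rx0 dr.
have TT := ode_time c0 m0 crho rm dr.
split.
  by have := TT x0 h (lexx _) x0h (lexx _); rewrite rx0 time_m// subr0 rr Tm; lra.
move=> e0 x; rewrite in_itv/= => /andP[x_0 xh].
have t1 := TT x0 x; rewrite e0 in t1; have := t1 (lexx _) x_0 xh.
have t2 := TT x h; rewrite e0 in t2; have := t2 x_0 xh (lexx _).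
rewrite rr Tm -e0 rx0 time_m// e0 => h1 h2.
have tx : tau c m (rho x) = x by lra.
have [_ k _ _ _] := slope_atP c0 m0.
have rmx : m <= rho x by apply: rm; rewrite in_itv/= e0 x_0.
have qx : q c m (rho x) = Z c m x by rewrite -{2}tx k.
by rewrite /extremal -qx height_q.
Qed.

(** Reflection turns the left half into a solution of the same equation with minimum point - x0, so
    [ode_unique] applied to both halves forces x0 = 0. *)
Lemma energy_eq_extremal m x0 rho g : 0 < m -> tau c m r = h ->
  density (- h) h rho g -> (forall x, x \in `[- h, h] -> m <= rho x) ->
  rho (- h) = r -> rho h = r -> x0 \in `[- h, h] -> rho x0 = m ->
  {ae mu, forall x, x \in `[- h, x0] -> g x = -1 * q c m (rho x)} ->
  {ae mu, forall x, x \in `[x0, h] -> g x = 1 * q c m (rho x)} ->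
  forall x, x \in `[- h, h] -> rho x = ext c m x.
Proof.
move=> m0 Tm dg rm rl rr x0h rx0 ael aer.
have [hx0 x0h'] : - h <= x0 /\ x0 <= h by move: x0h; rewrite in_itv/= => /andP[].
have dgr : density x0 h rho g by exact: density_sub dg _ _ _.
have dgl : density (- h) x0 rho g by exact: density_sub dg _ _ _.
have cr := density_continuous x0h' dgr.
have cl := density_continuous hx0 dgl.
have qc a b k : {within `[a, b], continuous rho} ->
    {within `[a, b], continuous (fun x => k * q c m (rho x))}.
  move=> cab; apply: (@within_continuous_comp _ _ _ _ rho (fun y => k * q c m y)) cab => y _.
  by apply: (@continuousM R R (fun=> k) (q c m)); [exact: cst_continuous|exact: slope_of_height_continuous].
have dr x : x0 < x < h -> is_derive x 1 rho (q c m (rho x)).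
  by move=> xh; have := density_ae_derive dgr (qc _ _ 1 cr) aer xh; rewrite mul1r.
have dl x : - x0 < x < h -> is_derive x 1 (fun x => rho (- x)) (q c m (rho (- x))).
  move=> xh; have xh' : - h < - x < x0 by rewrite ltrN2 ltrNl andbC.
  have d := density_ae_derive dgl (qc _ _ (-1) cl) ael xh'.
  by apply: (der_eq (derC d (derN (der_id x)))); rewrite mulN1r mulrNN mulr1.
have rmr x : x \in `[x0, h] -> m <= rho x.
  by rewrite in_itv/= => /andP[? ?]; apply: rm; rewrite in_itv/=; apply/andP; split => //; exact: le_trans hx0 _.
have rml x : x \in `[- x0, h] -> m <= rho (- x).
  rewrite in_itv/= => /andP[? ?]; apply: rm; rewrite in_itv/= lerN2; apply/andP; split => //.
  by rewrite lerNl (le_trans _ (_ : - x0 <= x)) // lerN2.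
have cl' : {within `[- x0, h], continuous (fun x => rho (- x))}.
  by apply: (@within_continuous_compN _ _ _ rho); rewrite opprK.
have [r1 r2] := ode_unique m0 Tm x0h' cr rmr rr rx0 dr.
have nx0h : - x0 <= h by rewrite lerNl.
have rNN : rho (- - x0) = m by rewrite opprK.
have [l1 l2] := ode_unique m0 Tm nx0h cl' rml rl rNN dl.
have e0 : x0 = 0 by move: l1; rewrite oppr_le0 => l1; apply/eqP; rewrite eq_le r1.
move=> x; rewrite in_itv/= => /andP[hx xh]; have [x_0|/ltW x_0] := leP 0 x.
  by apply: r2 => //; rewrite in_itv/= x_0.
have := l2 _ (- x); rewrite opprK extremal_even//; apply; first by rewrite e0 oppr0.
by rewrite in_itv/= oppr_ge0 x_0 lerNl.
Qed.

(** With m the minimum of rho, Phi(m) <= E(rho) <= Phi(m1) <= Phi(m). Equality throughout makes m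
    minimal for Phi and leaves no excess. *)
Lemma minimizer_extremal m1 rho : Phi_minimal m1 -> minimizer h r c rho ->
  exists m, [/\ Phi_minimal m, tau c m r = h & forall x, x \in `[- h, h] -> rho x = ext c m x].
Proof.
move=> m1min [ad rmin].
have [g [m [x0 [dg mr x0h rx0 Hm]]]] := admissible_min ad.
have [_ [rp [rl rr]]] := ad; have [m0 mr'] := andP mr.
have [/andP[m10 m1r] m1m] := m1min.
have T1 := Phi_stationary c0 h0 m1min.1 m1m.
have Er : \int[mu]_(x in `[- h, h]) lagr c (rho x) (g x) <= Phi c h r m1.
  have := rmin _ (ext_admissible m10 m1r T1).
  by rewrite (Ec_density h0 c0 dg rp) ext_energy// lee_fin.
have ge := energy_ge c0 m0 h0 dg Hm rl rr x0h rx0.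
have mmin : Phi_minimal m.
  by split => // m' /m1m; apply: le_trans; exact: le_trans Er.
have Tm := Phi_stationary c0 h0 mr mmin.2.
have [ael aer] := energy_eq c0 m0 h0 dg Hm rl rr x0h rx0 (le_trans Er (m1m _ mr)).
by exists m; split => //; exact: (energy_eq_extremal m0 Tm dg Hm rl rr x0h rx0).
Qed.

End Fixed.
End Minimizers.

(** * Hyperbolic functions and the constants Xi, omega, Pi0 *)

Section Hyperbolic.
Variable R : realType.
Implicit Types (t x y w k : R).
Local Notation ch := (@coshR R).
Local Notation sh := (@sinhR R).
Local Notation S := (@slope_norm R).

Lemma coshR_gt0 t : 0 < ch t.
Proof. by rewrite divr_gt0// addr_gt0// expR_gt0. Qed.

Lemma expRVN t : expR t * expR (- t) = 1.
Proof. by rewrite -expRD subrr expR0. Qed.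

Lemma coshR_sinhR t : ch t ^+ 2 = 1 + sh t ^+ 2.
Proof.
have := expRVN t; rewrite /coshR /sinhR; move: (expR t) (expR (- t)) => a b ab.
by transitivity (a * b + ((a - b) / 2) ^+ 2); [field|rewrite ab].
Qed.

Lemma coshRN t : ch (- t) = ch t.
Proof. by rewrite /coshR opprK addrC. Qed.

Lemma coshR0 : ch 0 = 1. Proof. by rewrite /coshR oppr0 expR0; field. Qed.
Lemma sinhR0 : sh 0 = 0. Proof. by rewrite /sinhR oppr0 expR0; field. Qed.

Lemma sinhR_lt_coshR t : sh t < ch t.
Proof. by rewrite /sinhR /coshR ltr_pM2r// ltrD2l (@lt_trans _ _ 0) ?oppr_lt0 ?expR_gt0. Qed.

Lemma slope_norm_sinhR t : S (sh t) = ch t.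
Proof. by rewrite /slope_norm -coshR_sinhR sqrtr_sqr gtr0_norm ?coshR_gt0. Qed.

Lemma der_coshR t : is_derive t 1 ch (sh t).
Proof. by rewrite /coshR; deriv; rewrite /sinhR; field. Qed.

Lemma der_sinhR t : is_derive t 1 sh (ch t).
Proof. by rewrite /sinhR; deriv; rewrite /coshR; field. Qed.

Lemma sinhR_ge0 t : 0 <= t -> 0 <= sh t.
Proof. by move=> t0; rewrite divr_ge0// subr_ge0 ler_expR; lra. Qed.

Lemma sinhR_gt0 t : 0 < t -> 0 < sh t.
Proof. by move=> t0; rewrite divr_gt0// subr_gt0 ltr_expR; lra. Qed.

Lemma coshR_le x y : 0 <= x -> x <= y -> ch x <= ch y.
Proof.
move=> x0 xy; apply: (der_le xy (fun t _ => der_coshR t)).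
  by apply: continuous_subspaceT; exact: der_cont der_coshR.
by move=> t /andP[xt _]; rewrite sinhR_ge0// (le_trans x0)// ltW.
Qed.

Lemma coshR_ge1 t : 1 <= ch t.
Proof.
have h u : 0 <= u -> 1 <= ch u by move=> u0; rewrite -coshR0 coshR_le.
by have [/h//|/ltW t0] := leP 0 t; rewrite -coshRN h// oppr_ge0.
Qed.

Lemma sinhR_le x y : x <= y -> sh x <= sh y.
Proof.
move=> xy; apply: (der_le xy (fun t _ => der_sinhR t)).
  by apply: continuous_subspaceT; exact: der_cont der_sinhR.
by move=> t _; rewrite ltW// coshR_gt0.
Qed.

Lemma coshR_surj y : 1 <= y -> exists2 t, 0 <= t & ch t = y.
Proof.
move=> y1; have y0 : 0 < y by lra.
have B0 : 0 <= ln (2 * y) by rewrite ln_ge0//; lra.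
have cc : {within `[0, ln (2 * y)], continuous ch}.
  by apply: continuous_subspaceT; exact: der_cont der_coshR.
have yB : y <= ch (ln (2 * y)).
  rewrite /coshR lnK ?posrE ?mulr_gt0//.
  by have := expR_gt0 (- ln (2 * y)); lra.
have [|t] := IVT (v := y) B0 cc.
  by rewrite coshR0 ge_min le_max y1 yB orbT.
by rewrite in_itv/= => /andP[t0 _] e; exists t.
Qed.

Definition arcosh w : R := ln (w + Num.sqrt (w ^+ 2 - 1)).

Lemma arcosh_coshR t : 0 <= t -> arcosh (ch t) = t.
Proof.
move=> t0; rewrite /arcosh coshR_sinhR addrAC subrr add0r sqrtr_sqr ger0_norm ?sinhR_ge0//.
rewrite (_ : ch t + sh t = expR t) ?expRK//; by rewrite /coshR /sinhR; field.
Qed.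

Lemma arcosh_le x y : 1 <= x -> x <= y -> arcosh x <= arcosh y.
Proof.
move=> x1 xy; have x0 : 0 < x by lra.
rewrite ler_ln ?posrE ?ltr_pwDl ?sqrtr_ge0//; last by lra.
have y1 : 1 <= y by lra.
have y2 : 0 <= y ^+ 2 - 1 by rewrite subr_ge0 exprn_ege1.
by apply: lerD => //; rewrite ler_sqrt// lerD2r ler_sqr ?nnegrE//; lra.
Qed.

Lemma arcosh_continuous w : 1 <= w -> {for w, continuous arcosh}.
Proof.
move=> w1; have a0 : 0 < w + Num.sqrt (w ^+ 2 - 1) by rewrite ltr_pwDl ?sqrtr_ge0//; lra.
apply: (@continuous_comp _ _ _ (fun w => w + Num.sqrt (w ^+ 2 - 1)) (@ln R)); last first.
  exact: continuous_ln.
apply: (@continuousD _ _ _ (fun w : R => w)); first exact: cvg_id.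
apply: (@continuous_comp _ _ _ (fun w => w ^+ 2 - 1) (@Num.sqrt R)); last exact: sqrt_continuous.
have d : is_derive w 1 (fun w => w ^+ 2 - 1) (2%:R * w ^+ 1 * 1 + 0).
  by der.
exact: der_continuous d.
Qed.

Lemma der_arcosh w : 1 < w -> is_derive w 1 arcosh (Num.sqrt (w ^+ 2 - 1))^-1.
Proof.
move=> w1; have w2 : 0 < w ^+ 2 - 1 by rewrite subr_gt0 exprn_egt1.
have s0 : 0 < Num.sqrt (w ^+ 2 - 1) by rewrite sqrtr_gt0.
rewrite /arcosh; deriv; [by apply: addr_gt0 => //; lra|exact: w2|].
field; rewrite !gt_eqF//; apply: addr_gt0 => //; lra.
Qed.

(* If w > k sqrt (1 + w'^2), then w / k = cosh theta with theta' < 1 / k. *)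
Lemma catenary_compare k (dw : R -> R) (a b : R) (f : R -> R) : 0 < k -> a < b ->
  {within `[a, b], continuous f} -> (forall x, x \in `[a, b] -> k <= f x) ->
  (forall x, a < x < b -> [/\ is_derive x 1 f (dw x), 0 <= dw x & k * S (dw x) < f x]) ->
  arcosh (f b / k) - arcosh (f a / k) < (b - a) / k.
Proof.
move=> k0 ab cf kf df.
have fk x : x \in `[a, b] -> 1 <= f x / k by move=> /kf; rewrite ler_pdivlMr// mul1r.
have fk1 x : a < x < b -> 1 < f x / k.
  move=> /df[_ _]; rewrite ltr_pdivlMr// mul1r; apply: le_lt_trans.
  by rewrite ler_peMr ?slope_norm_ge1// ltW.
have cc : {within `[a, b], continuous (fun x => arcosh (f x / k))}.
  apply: (@within_continuous_comp _ _ _ _ f (fun y => arcosh (y / k))) cf => _ /set_mem [x /fk fx <-].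
  apply: (@continuous_comp _ _ _ (fun y => y / k) arcosh); last exact: arcosh_continuous.
  have d : is_derive (f x) 1 (fun y => y / k) (1 * k^-1 + f x * 0) by der.
  exact: der_continuous d.
have dd x : a < x < b -> is_derive x 1 (fun x => arcosh (f x / k))
    ((Num.sqrt ((f x / k) ^+ 2 - 1))^-1 * (dw x / k)).
  move=> xab; have [d _ _] := df x xab.
  apply: (@derC _ arcosh (fun x => f x / k) x _ _ (der_arcosh (fk1 x xab))).
  by apply: der_eq (derM d (der_cst k^-1 x)) _; rewrite mulr0 addr0.
have [x xab ->] := MVT_lt ab dd cc.
rewrite mulrC ltr_pM2l ?subr_gt0// mulrA -[ltRHS]mul1r ltr_pM2r ?invr_gt0//.
have [_ p0 kS] := df x xab; have s0 := slope_norm_gt0 (dw x).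
have h : S (dw x) < f x / k by rewrite ltr_pdivlMr// mulrC.
have h2 : dw x ^+ 2 < (f x / k) ^+ 2 - 1.
  rewrite ltrBrDl -slope_norm_sqr ltr_sqr ?nnegrE ?(ltW s0)//.
  by rewrite ltW// (lt_trans s0).
rewrite mulrC ltr_pdivrMr ?sqrtr_gt0 ?(le_lt_trans _ h2) ?sqr_ge0// mul1r.
by rewrite -{1}(ger0_norm p0) -sqrtr_sqr ltr_sqrt// (le_lt_trans _ h2)// sqr_ge0.
Qed.

(** With t = h / P, the catenary equation r = P cosh (h / P) reads phi t = h / r, and omega is phi
    (1 / Xi). *)
Definition phi t : R := t / ch t.

(** On [0, 1] the numerator cosh t - t sinh t of the derivative is positive because sinh t < cosh
    t. *)
Lemma phi_lt x y : 0 <= x -> x < y -> y <= 1 -> phi x < phi y.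
Proof.
move=> x0 xy y1.
have d t : is_derive t 1 phi ((ch t - t * sh t) / ch t ^+ 2).
  rewrite /phi; deriv; [by rewrite gt_eqF// coshR_gt0|exact: der_coshR|].
  by field; rewrite gt_eqF// coshR_gt0.
apply: (der_lt xy (fun t _ => d t)).
  by apply: continuous_subspaceT; exact: der_cont d.
move=> t /andP[xt ty]; rewrite divr_gt0 ?exprn_gt0 ?coshR_gt0// subr_gt0.
have s0 : 0 < sh t by apply: sinhR_gt0; lra.
apply: le_lt_trans (sinhR_lt_coshR t).
by rewrite ler_piMl ?(ltW s0)//; lra.
Qed.

Lemma phi_le x y : 0 <= x -> x <= y -> y <= 1 -> phi x <= phi y.
Proof. by move=> x0; rewrite le_eqVlt => /predU1P[->//|xy] y1; apply/ltW/phi_lt. Qed.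

Lemma expR_ge_pow x n : -n.+1%:R <= x -> (1 + x / n.+1%:R) ^+ n.+1 <= expR x.
Proof.
move=> nx; have -> : expR x = expR (x / n.+1%:R) ^+ n.+1.
  by rewrite -expRM_natl mulrC divfK.
apply: lerXn2r; rewrite ?nnegrE ?expR_ge0 ?expR_ge1Dx//.
by rewrite -lerBlDl sub0r ler_pdivlMr// mulN1r.
Qed.

Lemma ln2_lb : (5/8 : R) <= ln 2.
Proof.
rewrite -[leLHS]expRK ler_ln ?posrE ?expR_gt0//.
(* Exponent 5: (7/8)^5 > 1/2. *)
have := @expR_ge_pow (- (5/8)) 4; rewrite expRN => /(_ _).
have h : - 5%:R <= - (5 / 8) :> R by lra.
move=> /(_ h); have e0 := expR_gt0 (5/8 : R).
have : 1 / 2 <= (1 + - (5 / 8) / 5) ^+ 5 :> R by rewrite !exprS expr0; lra.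
move=> h1 h2; have := le_trans h1 h2.
by rewrite -[leRHS]mul1r ler_pdivlMr//; lra.
Qed.

Lemma ln2_ub : ln 2 <= (18/25 : R).
Proof.
rewrite -[leRHS]expRK ler_ln ?posrE ?expR_gt0//.
(* Exponent 12: 1.06^12 > 2. *)
apply: le_trans (@expR_ge_pow (18/25) 11 _); last by lra.
by rewrite !exprS expr0; lra.
Qed.

Lemma coshR_ln2 : ch (ln 2) = 5/4.
Proof. by rewrite /coshR expRN lnK ?posrE//; field. Qed.

End Hyperbolic.

Section Omega.
Variable R : realType.
Local Notation ch := (@coshR R).
Local Notation sh := (@sinhR R).

(** This holds since cosh t - sinh t = exp (- t). It turns the equation of Xi, with t = 1 / Xi, into
    2 t = 1 + exp (- 2 t). *)
Lemma coshR_expN (t : R) : ch t * (ch t - sh t) = (1 + expR (- (2 * t))) / 2.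
Proof.
have := expRVN t; have -> : expR (- (2 * t)) = expR (- t) * expR (- t).
  by rewrite -expRD; congr expR; ring.
rewrite /coshR /sinhR; move: (expR t) (expR (- t)) => a b ab.
by transitivity ((a * b + b * b) / 2); [field|rewrite ab].
Qed.

(** At ln 2 the function 2 t - exp (- 2 t) equals 2 ln 2 - 1/4, which is at least 1 exactly when ln
    2 >= 5/8. *)
Lemma critical_parameter : exists2 t : R, 0 < t <= ln 2 & 2 * t = 1 + expR (- (2 * t)).
Proof.
pose f (t : R) := 2 * t - expR (- (2 * t)).
have d (t : R) : is_derive t 1 f (2 + 2 * expR (- (2 * t))).
  by rewrite /f; deriv; ring.
have l0 : (0 : R) <= ln 2 by have := ln2_lb R; lra.
have cf : {within `[0, ln 2], continuous f} by apply: continuous_subspaceT; exact: der_cont d.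
have [|t] := IVT (v := 1) l0 cf.
  have e : expR (- (2 * ln 2)) = 1/4 :> R.
    have -> : - (2 * ln 2) = - ln 2 - ln 2 :> R by ring.
    by rewrite expRD expRN lnK ?posrE//; field.
  rewrite /f e mulr0 oppr0 expR0 ge_min le_max; apply/andP; split; apply/orP; [left|right]; last first.
    by have := ln2_lb R; lra.
  by lra.
rewrite in_itv/= => /andP[t0 t2] e; exists t; last by rewrite /f in e; lra.
rewrite t2 andbT lt_neqAle t0 andbT; apply/eqP => e0; move: e.
by rewrite /f -e0 mulr0 oppr0 expR0; lra.
Qed.

(** One side of the transformed equation increases in t and the other decreases, so the set defining
    [Xi] is a singleton and its supremum is the solution. *)
Lemma omegaE (t : R) : 0 < t -> 2 * t = 1 + expR (- (2 * t)) -> omega R = phi t.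
Proof.
move=> t0 et.
have E : [set xi : R | 0 < xi /\ xi * tanhR xi^-1 + (sechR xi^-1) ^+ 2 = xi] = [set t^-1].
  apply/seteqP; split => xi /=; last first.
    move=> ->; rewrite invr_gt0 invrK; split => //.
    have := coshR_expN t; rewrite -et; have c0 := coshR_gt0 t.
    rewrite /tanhR /sechR => e.
    rewrite (_ : 2 * t / 2 = t) in e; last by field.
    have -> : t^-1 * (sh t / ch t) + (ch t)^-1 ^+ 2 = (sh t * ch t + t) / (t * ch t ^+ 2).
      by field; rewrite !gt_eqF.
    have -> : sh t * ch t + t = ch t ^+ 2 by rewrite -[X in _ + X]e; ring.
    by field; rewrite !gt_eqF.
  move=> [x0 e]; set s := xi^-1 in e.
  have s0 : 0 < s by rewrite invr_gt0.
  have c0 := coshR_gt0 s.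
  have es : 2 * s = 1 + expR (- (2 * s)).
    have := coshR_expN s; have xs : xi = s^-1 by rewrite /s invrK.
    rewrite xs /tanhR /sechR in e => e2.
    have : s = ch s * (ch s - sh s).
      have : (s^-1 * (sh s / ch s) + (ch s)^-1 ^+ 2) * (s * ch s ^+ 2) = s^-1 * (s * ch s ^+ 2).
        by rewrite e.
      have -> : (s^-1 * (sh s / ch s) + (ch s)^-1 ^+ 2) * (s * ch s ^+ 2) = sh s * ch s + s.
        by field; rewrite !gt_eqF.
      have -> : s^-1 * (s * ch s ^+ 2) = ch s ^+ 2 by field; rewrite !gt_eqF.
      move=> h; have h2 : s = ch s ^+ 2 - sh s * ch s by rewrite -h; ring.
      by rewrite {1}h2; ring.
    by rewrite e2 => e3; rewrite {1}e3; field.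
  have st : s = t.
    apply/eqP; rewrite eq_le; apply/andP; split; rewrite leNgt; apply/negP => h.
      have : expR (- (2 * s)) < expR (- (2 * t)) by rewrite ltr_expR; lra.
      by lra.
    have : expR (- (2 * t)) < expR (- (2 * s)) by rewrite ltr_expR; lra.
    by lra.
  by rewrite -st /s invrK.
by rewrite /omega /Xi E sup1 invrK /phi invfM invrK.
Qed.

Lemma catenary_parameter (h r : R) : 0 < h -> 0 < r -> h / r <= omega R ->
  exists t0, [/\ 0 < t0 <= ln 2, phi t0 = h / r & 2 * t0 <= 1 + expR (- (2 * t0))].
Proof.
move=> h0 r0; have [t /andP[tp t2] et] := critical_parameter.
rewrite (omegaE tp et) => hw.
have cp : {within `[0, t], continuous (@phi R)}.
  apply: continuous_subspaceT => x.
  notypeclasses refine (@der_continuous _ (@phi R) x _ _); rewrite /phi.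
  by der; [rewrite gt_eqF// coshR_gt0|exact: der_coshR].
have [|t0] := IVT (v := h / r) (ltW tp) cp.
  have -> : phi 0 = 0 :> R by rewrite /phi mul0r.
  have hr0 : 0 <= h / r by rewrite divr_ge0 ?ltW.
  by rewrite ge_min le_max hr0 hw orbT.
rewrite in_itv/= => /andP[t00 t0t] e; exists t0; split => //.
  rewrite (le_trans t0t)// andbT lt_neqAle t00 andbT; apply/eqP => e0.
  by move: e; rewrite -e0 /phi mul0r => /eqP; rewrite lt_eqF// divr_gt0.
apply: (@le_trans _ _ (2 * t)); first by rewrite ler_pM2l.
by rewrite et lerD2l ler_expR lerN2 ler_pM2l.
Qed.

(** The largest P corresponds to the smallest t = h / P: a larger P would give a second parameter
    below t0 with the same phi, against monotonicity on [0, 1]. *)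
Lemma Pi0E (h r t0 : R) : 0 < h -> 0 < r -> 0 < t0 -> t0 <= 1 -> phi t0 = h / r ->
  Pi0 h r = h / t0.
Proof.
move=> h0 r0 t00 t01 e; have c0 := coshR_gt0 t0.
have rE : r = h / t0 * ch t0.
  have -> : h = phi t0 * r by rewrite e divfK// gt_eqF.
  by rewrite /phi; field; rewrite !gt_eqF.
set E := [set P : R | 0 < P /\ r = P * ch (h / P)].
have E0 : E (h / t0).
  split; first by rewrite divr_gt0.
  by rewrite (_ : h / (h / t0) = t0)//; field; rewrite !gt_eqF.
have ub P : E P -> P <= h / t0.
  move=> [P0 rP]; rewrite leNgt; apply/negP => lt.
  have t1 : h / P < t0 by rewrite ltr_pdivrMr// mulrC -ltr_pdivrMr.
  have := phi_lt (divr_ge0 (ltW h0) (ltW P0)) t1 t01.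
  rewrite e rP /phi; have := coshR_gt0 (h / P); move: (ch (h / P)) => C C0.
  have -> : h / P / C = h / (P * C) by field; rewrite !gt_eqF.
  by rewrite ltxx.
apply/eqP; rewrite /Pi0 -/E eq_le; apply/andP; split.
  by apply: ge_sup => //; exists (h / t0).
by apply: sup_upper_bound => //; split; [exists (h / t0)|exists (h / t0)].
Qed.

End Omega.

(** * The catenary minimizes the area *)

Section Catenary.
Variable R : realType.
Notation mu := (@lebesgue_measure R).
Local Notation ch := (@coshR R).
Local Notation sh := (@sinhR R).
Local Notation S := (@slope_norm R).
Local Notation Y := (@height R).
Local Notation X := (@abscissa R).
Local Notation Z := (@slope_at R).
Local Notation Phi := (@reduced_energy R).
Local Notation ext := (@extremal R).

(** * The case c = 0: extremals are catenaries *)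

Section Soap.
Variables (m : R) (m0 : 0 < m).

Let z0 : (0 : R) <= 0 := lexx 0.

Lemma height_soap p : Y 0 m p = m * S p.
Proof.
rewrite /height mulr0 mul0r addr0 sqrtr_sqr ger0_norm; last by rewrite mulr_ge0// ltW// slope_norm_gt0.
by field.
Qed.

Lemma abscissa_sh t : X 0 m (sh t) = m * t.
Proof.
have d (u : R) : is_derive u 1 (fun u => X 0 m (sh u) - m * u) 0.
  deriv; [exact: (derC (der_abscissa z0 m0 _) (der_sinhR u))|].
  rewrite /speed height_soap slope_norm_sinhR; have c0 := coshR_gt0 u.
  by field; rewrite !gt_eqF//=; have := mulr_gt0 m0 c0; lra.
have := is_derive_0_is_cst t 0 d.
by rewrite /= sinhR0 abscissa0// mulr0 subr0 => /eqP; rewrite subr_eq0 => /eqP.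
Qed.

Lemma slope_at_soap x : Z 0 m x = sh (x / m).
Proof.
have [_ k _ _ _] := slope_atP z0 m0.
by rewrite -[RHS]k abscissa_sh mulrC divfK// gt_eqF.
Qed.

Lemma extremal_soap x : ext 0 m x = m * ch (x / m).
Proof. by rewrite /extremal slope_at_soap height_soap slope_norm_sinhR. Qed.

Lemma action_soap t : 0 <= t -> action 0 m (m * ch t) = m ^+ 2 * (sh t * ch t - t) / 2.
Proof.
move=> t0.
have d (u : R) : 0 < u < t -> is_derive u 1
    (fun u => action 0 m (m * ch u) - m ^+ 2 * (sh u * ch u - u) / 2) 0.
  move=> /andP[u0 _]; have s0 := sinhR_ge0 (ltW u0).
  have da : is_derive u 1 (fun u => m * ch u) (m * sh u).
    by deriv; [exact: der_coshR|rewrite mul0r add0r].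
  deriv; [exact: (derC (der_action z0 m0 _) da)|exact: der_sinhR|exact: der_coshR|].
  have W1 : field_slope 0 m (m * ch u) = m * sh u.
    rewrite -slope_norm_sinhR -height_soap field_slope_height// height_soap /lagr_p !mul0r addr0 slope_norm_sinhR.
    by field; rewrite gt_eqF// coshR_gt0.
  cbv beta; rewrite W1.
  have c0 := coshR_gt0 u; have cs := coshR_sinhR u; have sE : sh u ^+ 2 = ch u ^+ 2 - 1 by rewrite cs addrC addKr.
  have -> : ch u * ch u + sh u * sh u - 1 = 2 * sh u ^+ 2 by rewrite sE -!expr2 sE; ring.
  by field.
have := der_cst_in t0 d; rewrite coshR0 sinhR0 mulr1 action_m// !mul0r subrr mulr0 mul0r subrr => /(_ _)/esym.
move=> H; apply/eqP; rewrite -subr_eq0; apply/eqP; apply: H.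
apply: continuous_subspaceT => u.
notypeclasses refine (@der_continuous _ _ u _ _).
by der; [exact: (derC (der_action z0 m0 _) (derM (der_cst m u) (der_coshR u)))|exact: der_sinhR|exact: der_coshR].
Qed.

End Soap.

(** * Optimality of the catenary under the bound on h / r *)

Section Optimal.
Variables (h r t0 : R) (h0 : 0 < h) (r0 : 0 < r).
Hypotheses (t00 : 0 < t0) (t02 : t0 <= ln 2) (et : phi t0 = h / r).
Hypothesis ct : 2 * t0 <= 1 + expR (- (2 * t0)).

Let t01 : t0 <= 1. Proof. by apply: (le_trans t02); apply: (le_trans (ln2_ub R)); lra. Qed.

(* Reduced energy of the soap film, in units of r^2, at m = r / cosh t. *)
Let G t := 2 * phi t0 / ch t + sh t / ch t - t / ch t ^+ 2.

Let PhiG (t : R) : 0 <= t -> Phi 0 h r (r / ch t) = r ^+ 2 * G t.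
Proof.
move=> tp; have c0 := coshR_gt0 t; have m0 : 0 < r / ch t by rewrite divr_gt0.
rewrite /reduced_energy (_ : action _ _ r = action 0 (r / ch t) ((r / ch t) * ch t)); last first.
  by rewrite divfK// gt_eqF.
rewrite action_soap// /G et; field; by rewrite !gt_eqF.
Qed.

Let dG (t : R) : is_derive t 1 G (2 * sh t / ch t ^+ 3 * (t - phi t0 * ch t)).
Proof.
have c0 := coshR_gt0 t; have c1 : ch t != 0 by rewrite gt_eqF.
rewrite /G; deriv; [exact: c1|exact: der_coshR|exact: der_sinhR|exact: c1|exact: der_coshR|exact: expf_neq0|exact: der_coshR|].
have sE : sh t ^+ 2 = ch t ^+ 2 - 1 by rewrite coshR_sinhR addrC addKr.
have -> : ch t / ch t + sh t * (- sh t / ch t ^+ 2) = 1 / ch t ^+ 2.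
  by have -> : 1 = ch t ^+ 2 - sh t ^+ 2 by [rewrite sE; ring]; field.
by field.
Qed.

Let cG : continuous G. Proof. exact: der_cont dG. Qed.

(** The value 1 is the energy r^2 of the degenerate limit m -> 0; the hypothesis [ct] is exactly
    this comparison. *)
Let G_t0 : G t0 <= 1.
Proof.
have c0 := coshR_gt0 t0; have := coshR_expN t0 => e.
have : t0 <= ch t0 * (ch t0 - sh t0) by rewrite e; move: ct; lra.
rewrite /G /phi => h1.
have -> : 2 * (t0 / ch t0) / ch t0 + sh t0 / ch t0 - t0 / ch t0 ^+ 2 =
  (t0 + sh t0 * ch t0) / ch t0 ^+ 2 by field; rewrite gt_eqF.
rewrite ler_pdivrMr ?exprn_gt0// mul1r; move: h1; rewrite mulrBr -expr2 [sh t0 * _]mulrC; lra.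
Qed.

Let dG_factor (x : R) : 0 <= x -> 0 <= 2 * sh x / ch x ^+ 3.
Proof.
by move=> xp; apply: divr_ge0; [apply: mulr_ge0 => //; exact: sinhR_ge0|exact/exprn_ge0/ltW/coshR_gt0].
Qed.

(** By [dG], the sign of G' is that of t - phi(t0) cosh t. Up to t0 this is nonpositive by
    monotonicity of phi. Beyond t0, either k(t) >= 0 and concavity keeps k nonnegative on the way
    from t0, so G increases, or k(t) < 0, which forces t > 1 and then G(t) >= 1 >= G(t0). *)
Let G_min (t : R) : 0 <= t -> G t0 <= G t.
Proof.
move=> tp; have [tt|tt] := leP t t0.
  rewrite -lerN2; apply: (der_le tt (f := fun t => - G t) (fun x _ => derN (dG x))).
    by apply: continuous_subspaceT => x; apply: continuousN; exact: cG.
  move=> x /andP[tx xt]; have xp := le_lt_trans tp tx.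
  rewrite oppr_ge0; apply: mulr_ge0_le0.
    exact/dG_factor/ltW.
  rewrite subr_le0 -ler_pdivrMr ?coshR_gt0//; exact: (phi_le (ltW xp) (ltW xt) t01).
pose k u := u - phi t0 * ch u.
have dk (u : R) : is_derive u 1 k (1 - phi t0 * sh u).
  by rewrite /k; deriv; [exact: der_coshR|rewrite mul0r add0r].
have ck : continuous k := der_cont dk.
have k0 : k t0 = 0 by rewrite /k /phi divfK ?subrr// gt_eqF// coshR_gt0.
have p0 : 0 <= phi t0 by rewrite et divr_ge0 ?ltW.
have [kt|kt] := leP 0 (k t).
  apply: (der_le (ltW tt) (fun x _ => dG x)).
    by apply: continuous_subspaceT; exact: cG.
  move=> x /andP[tx xt]; have xp : 0 <= x := ltW (lt_trans t00 tx).
  apply: mulr_ge0.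
    exact: dG_factor.
  (* k is concave *)
  rewrite leNgt; apply/negP => kx.
  have cks a b : {within `[a, b], continuous k} by exact: continuous_subspaceT.
  have [a /andP[ta ax] ea] := MVT_lt tx (fun x _ => dk x) (cks _ _).
  have [b /andP[xb bt] eb] := MVT_lt xt (fun x _ => dk x) (cks _ _).
  have ha : 1 - phi t0 * sh a < 0.
    by rewrite -(pmulr_llt0 _ (_ : 0 < x - t0)) ?subr_gt0// -ea k0 subr0.
  have hb : 0 < 1 - phi t0 * sh b.
    rewrite -(pmulr_lgt0 _ (_ : 0 < t - x)) ?subr_gt0// -eb subr_gt0.
    exact: lt_le_trans kt.
  have : phi t0 * sh a <= phi t0 * sh b by rewrite ler_wpM2l// sinhR_le// ltW// (lt_trans ax).
  by lra.
have t1 : 1 < t.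
  rewrite ltNge; apply/negP => t1; move: kt; rewrite ltNge => /negP; apply.
  rewrite /k subr_ge0 -ler_pdivlMr ?coshR_gt0//; exact: (phi_le (ltW t00) (ltW tt) t1).
apply: le_trans G_t0 _; have c0 := coshR_gt0 t.
have h1 : ch t * (ch t - sh t) <= t.
  have e1 : expR (- (2 * t)) <= 1 by rewrite -[leRHS]expR0 ler_expR; lra.
  by rewrite coshR_expN; lra.
have h2 : t <= phi t0 * ch t by move: kt; rewrite /k; lra.
rewrite /G.
have -> : 2 * phi t0 / ch t + sh t / ch t - t / ch t ^+ 2 =
  (2 * (phi t0 * ch t) + sh t * ch t - t) / ch t ^+ 2 by field; rewrite gt_eqF.
rewrite ler_pdivlMr ?exprn_gt0// mul1r; move: h1; rewrite mulrBr -expr2 [ch t * sh t]mulrC; lra.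
Qed.

Let catenary_height : h / t0 = r / ch t0.
Proof.
have c0 := coshR_gt0 t0; have -> : h = phi t0 * r by rewrite et divfK// gt_eqF.
by rewrite /phi; field; rewrite !gt_eqF.
Qed.

Lemma Phi_minimal_soap : Phi_minimal h r 0 (h / t0).
Proof.
have c0 := coshR_gt0 t0.
split.
  by rewrite divr_gt0//= catenary_height ler_pdivrMr// ler_peMr ?coshR_ge1// ltW.
move=> m /andP[m0 mr].
have [|t tp et'] := @coshR_surj R (r / m); first by rewrite ler_pdivlMr// mul1r.
have -> : m = r / ch t by rewrite et'; field; rewrite !gt_eqF.
rewrite catenary_height !PhiG// ?ler_pM2l ?exprn_gt0 ?G_min//.
by rewrite ltW.
Qed.

End Optimal.
End Catenary.

(** * Comparison with the catenary *)

Section Consequences.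
Variable R : realType.
Notation mu := (@lebesgue_measure R).
Local Notation ch := (@coshR R).
Local Notation sh := (@sinhR R).
Local Notation S := (@slope_norm R).
Local Notation Y := (@height R).
Local Notation V := (@speed R).
Local Notation Z := (@slope_at R).
Local Notation ext := (@extremal R).
Local Notation tau := (@time R).

Lemma strictly_convex_derive (h : R) (f df : R -> R) : (forall x : R, is_derive x 1 f (df x)) ->
  {homo df : x y / x < y} -> strictly_convex_on h f.
Proof.
move=> fd dlt.
have cf a b : {within `[a, b], continuous f} by apply: continuous_subspaceT; exact: der_cont fd.
have main (x y t : R) : x < y -> 0 < t < 1 -> f (t * x + (1 - t) * y) < t * f x + (1 - t) * f y.
  move=> xy /andP[t0 t1]; set z := t * x + (1 - t) * y.
  have yx : 0 < y - x by rewrite subr_gt0.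
  have zx : z - x = (1 - t) * (y - x) by rewrite /z; ring.
  have yz : y - z = t * (y - x) by rewrite /z; ring.
  have xz : x < z by rewrite -subr_gt0 zx mulr_gt0// subr_gt0.
  have zy : z < y by rewrite -subr_gt0 yz mulr_gt0.
  have [a /andP[xa az] ea] := MVT_lt xz (fun x _ => fd x) (cf _ _).
  have [b /andP[zb by_] eb] := MVT_lt zy (fun x _ => fd x) (cf _ _).
  have ab := dlt _ _ (lt_trans az zb).
  rewrite -subr_gt0.
  have -> : t * f x + (1 - t) * f y - f z = (1 - t) * (f y - f z) - t * (f z - f x) by ring.
  rewrite ea eb zx yz.
  have -> : (1 - t) * (df b * (t * (y - x))) - t * (df a * ((1 - t) * (y - x))) =
    (1 - t) * t * (y - x) * (df b - df a) by ring.
  by rewrite !mulr_gt0// subr_gt0.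
move=> x y t xh yh; rewrite neq_lt => /orP[xy|yx] t01; first exact: main.
have := main y x (1 - t) yx; rewrite (_ : 1 - (1 - t) = t); last by ring.
rewrite [X in _ -> f X < _]addrC [X in _ -> _ < X]addrC; apply.
by case/andP: t01 => ? ?; apply/andP; split; lra.
Qed.

(** A minimizer is known on the closed interval only, so one-sided derivatives at the ends are taken
    over from the extremal, which is smooth on the line; Caratheodory's function is the continuous
    extension of the difference quotient. *)
Lemma derive_has_deriv_within (h : R) (f f' : R -> R) (x d : R) : x \in `[- h, h] ->
  (forall y, y \in `[- h, h] -> f y = f' y) -> is_derive x 1 f' d -> has_deriv_within h f x d.
Proof.
move=> xh ff' /is_derive1_caratheodory [g [gE cg gx]].
rewrite /has_deriv_within; apply/cvgrPdist_lt => e e0.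
have /cvgrPdist_lt/(_ _ e0) := cg; rewrite gx => -[dl /= dl0 D].
rewrite near_withinE; apply/nbhs_ballP; exists dl => //= y yx yne yh.
have yx0 : y - x != 0 by rewrite subr_eq0.
by rewrite !ff'// gE mulfK//; exact: D.
Qed.

Section Fixed.
Variables (h r : R) (h0 : 0 < h) (r0 : 0 < r).

Let hh : - h <= h. Proof. by rewrite ge0_cp// ltW. Qed.

Let constant_density : density (- h) h (fun=> r) (fun=> 0).
Proof.
apply: (@primitive_density R (fun=> r) (fun=> 0) (- h) h (fun y => der_cst r y)).
by move=> x; exact: cst_continuous.
Qed.

Lemma constant_admissible : admissible h r (fun=> r).
Proof. by split; [exact: density_W11 constant_density|]. Qed.

Lemma Ec_constant (c : R) : 0 <= c -> Ec h c (fun=> r) = (2 * h * r)%:E.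
Proof.
move=> c0; have dg := constant_density.
rewrite (Ec_density h0 c0 dg)//; congr (_%:E).
rewrite (_ : (fun x => lagr c r 0) = fun=> r); last first.
  by apply/funext => x; rewrite /lagr slope_norm0 expr0n mul0r mulr0 addr0 mulr1.
rewrite Rintegral_cst//.
have -> : fine ((@lebesgue_measure R) `[- h, h]%classic) = 2 * h.
  rewrite lebesgue_measure_itv/= lte_fin gtrN// -EFinD/=; ring.
by rewrite mulrC.
Qed.

(* Pointwise AM-GM: area + s^2 bend >= 2 s |rho'|. *)
Lemma energy_descent (rho g : R -> R) (m x0 s : R) : density (- h) h rho g ->
  (forall x, x \in `[- h, h] -> 0 < rho x) -> rho (- h) = r -> rho h = r ->
  x0 \in `[- h, h] -> rho x0 = m -> 0 <= s ->
  4 * s * (r - m) <= \int[mu]_(x in `[- h, h]) area_density rho g x +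
    s ^+ 2 * \int[mu]_(x in `[- h, h]) bend_density rho g x.
Proof.
move=> dg rp rl rr x0h rx0 s0.
have [hx0 x0h'] : - h <= x0 /\ x0 <= h by move: x0h; rewrite in_itv/= => /andP[].
have gi := dg.1; have agi := itg_norm gi.
rewrite -int_lagr//.
apply: (@le_trans _ _ (2 * s * \int[mu]_(x in `[- h, h]) `|g x|)).
  rewrite (_ : 4 * s * (r - m) = 2 * s * (2 * (r - m))); last by ring.
  apply: ler_wpM2l; first by rewrite mulr_ge0.
  (* The curve descends from r to m and climbs back, so the total variation is at least 2 (r -
     m). *)
  rewrite (@Rint_cat _ (- h) x0 h) ?hx0//.
  have gl : itg (- h) x0 g by exact: itgS gi.
  have gr : itg x0 h g by exact: itgS gi.
  have hl : r - m <= \int[mu]_(t in `[- h, x0]) `|g t|.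
    apply: le_trans (le_normr_Rintegral _ gl) => //.
    by rewrite (density_diff dg)// rl rx0 -normrN opprB ler_norm.
  have hr : r - m <= \int[mu]_(t in `[x0, h]) `|g t|.
    apply: le_trans (le_normr_Rintegral _ gr) => //.
    by rewrite (density_diff dg)// rr rx0 ler_norm.
  by rewrite mulr_natl mulr2n; apply: lerD.
rewrite -RintegralZl//; apply: le_Rintegral => //; [exact: itgZ|exact: itg_lagr|].
move=> x xh; have y0 := rp x xh; rewrite /lagr.
have slope_norm0 := slope_norm_gt0 (g x); set u := rho x * S (g x); have u0 : 0 < u by rewrite mulr_gt0.
rewrite -subr_ge0 -(real_normK (num_real (g x))); set n := `|g x|.
have -> : u + s ^+ 2 * (n ^+ 2 / u) - 2 * s * n = (u - s * n) ^+ 2 / u.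
  by field; rewrite gt_eqF.
by rewrite divr_ge0 ?sqr_ge0// ltW.
Qed.

(** * Minimizers lie above the catenary *)

Section Comparison.
Variables (t0 c : R) (t00 : 0 < t0) (t02 : t0 <= ln 2) (et : phi t0 = h / r).
Hypothesis ct : 2 * t0 <= 1 + expR (- (2 * t0)).
Hypothesis c0 : 0 < c.
Let k := h / t0.

Let k0 : 0 < k. Proof. by rewrite divr_gt0. Qed.
Let t0u : t0 <= 18/25. Proof. exact: le_trans (ln2_ub R). Qed.
Let t01 : t0 <= 1. Proof. by apply: (le_trans t0u); lra. Qed.
Let kmin : Phi_minimal h r 0 k. Proof. exact: Phi_minimal_soap. Qed.
Let z0 : (0 : R) <= 0 := lexx 0.
Let kr : k <= r. Proof. by case: kmin => /andP[]. Qed.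
Let Tk : tau 0 k r = h. Proof. by case: kmin => kr' km; exact: Phi_stationary km. Qed.

Let hr_ub : h <= 72 / 125 * r.
Proof.
rewrite -ler_pdivrMr// -et.
(* phi (ln 2) = ln 2 / (5/4), and (18/25) / (5/4) = 72/125. *)
apply: (@le_trans _ _ (phi (ln 2))).
  by apply: phi_le => //; [exact: ltW|apply: (le_trans (ln2_ub R)); lra].
rewrite /phi coshR_ln2; have l := ln2_ub R.
by rewrite ler_pdivrMr//; apply: (le_trans l); lra.
Qed.

(** The bending density of the catenary is (1 - 1 / cosh^2) / k, at most (1 - 16/25) / k since cosh
    <= 5/4. Over length 2 h = 2 k t0 this gives (18/25) t0 <= (18/25)^2 < 81/156. *)
Let bend_soap : \int[mu]_(x in `[- h, h]) bend_density (ext 0 k) (Z 0 k) x <= 81 / 156.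
Proof.
have dk := ext_density h z0 k0.
have kp x : x \in `[- h, h] -> 0 < ext 0 k x by move=> _; exact: height_gt0.
apply: (@le_trans _ _ (\int[mu]_(x in `[- h, h]) (9 / 25 / k))).
  apply: le_Rintegral => //; [exact: itg_bend|exact: itg_cst|].
  move=> x; rewrite /= in_itv/= => /andP[hx xh].
  rewrite /bend_density extremal_soap// slope_at_soap// slope_norm_sinhR; set u := x / k.
  have c1 := coshR_gt0 u.
  have cu : ch u <= 5 / 4.
    rewrite -coshR_ln2.
    have ul : u <= t0.
      by rewrite /u /k ler_pdivrMr// mulrC divfK ?gt_eqF.
    have un : - u <= t0.
      by rewrite /u /k -mulNr ler_pdivrMr// mulrC divfK ?gt_eqF// lerNl.
    have [up|/ltW up] := leP 0 u; first by apply: coshR_le => //; exact: le_trans t02.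
    by rewrite -coshRN; apply: coshR_le; [rewrite oppr_ge0|exact: le_trans t02].
  have su : sh u ^+ 2 = ch u ^+ 2 - 1 by rewrite coshR_sinhR addrC addKr.
  rewrite su.
  have -> : (ch u ^+ 2 - 1) / (k * ch u * ch u) = (1 - 1 / ch u ^+ 2) / k by field; rewrite !gt_eqF.
  rewrite ler_pM2r ?invr_gt0//.
  have : 16 / 25 <= 1 / ch u ^+ 2.
    by rewrite ler_pdivlMr ?exprn_gt0//; have := coshR_ge1 u; nra.
  by lra.
rewrite Rintegral_cst//.
have -> : fine ((@lebesgue_measure R) `[- h, h]%classic) = 2 * h.
  rewrite lebesgue_measure_itv/= lte_fin gtrN// -EFinD/=; ring.
have -> : 9 / 25 / k * (2 * h) = 18 / 25 * t0.
  by rewrite /k; field; rewrite !gt_eqF.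
by apply: (@le_trans _ _ (18 / 25 * (18 / 25))); [rewrite ler_pM2l//; lra|lra].
Qed.

(** The catenary has the least area and the extremal the least E_c, so the extremal bends at most as
    much as the catenary, uniformly in c. The constant r bounds its area by 2 h r, and
    [energy_descent] then limits the descent r - m. The result places h / m in [0, 1], where phi is
    known to increase. *)
Lemma minimum_gt_h (m : R) : 0 < m -> m <= r -> tau c m r = h ->
  minimizer h r c (ext c m) -> h < m.
Proof.
move=> m0 mr Tm [ad Emin].
have c0' := ltW c0.
have dm := ext_density h c0' m0; have dk := ext_density h z0 k0.
have mp x : x \in `[- h, h] -> 0 < ext c m x by move=> _; exact: height_gt0.
have kp x : x \in `[- h, h] -> 0 < ext 0 k x by move=> _; exact: height_gt0.
set a1 := \int[mu]_(x in `[- h, h]) area_density (ext c m) (Z c m) x.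
set b1 := \int[mu]_(x in `[- h, h]) bend_density (ext c m) (Z c m) x.
set a0 := \int[mu]_(x in `[- h, h]) area_density (ext 0 k) (Z 0 k) x.
set b0 := \int[mu]_(x in `[- h, h]) bend_density (ext 0 k) (Z 0 k) x.
have b1p : 0 <= b1 by apply: Rintegral_ge0 => x xh; apply: bend_density_ge0; exact: mp.
have le1 : a0 <= a1.
  have [_ kmin'] := Phi_minimal_minimizer h0 z0 kmin.
  have := kmin' _ ad; rewrite (Ec_density h0 z0 dk kp) (Ec_density h0 z0 dm mp) lee_fin.
  rewrite (int_lagr hh dk kp) (int_lagr hh dm mp) -/a0 -/a1 -/b0 -/b1.
  by move: (a0) (a1) (b0) (b1) => u v u' v'; rewrite !mul0r !addr0.
have le2 : a1 + c * b1 <= a0 + c * b0.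
  have := Emin _ (ext_admissible z0 k0 kr Tk).
  by rewrite (Ec_density h0 c0' dk kp) (Ec_density h0 c0' dm mp) lee_fin (int_lagr hh dk kp) (int_lagr hh dm mp).
have le3 : a1 + c * b1 <= 2 * h * r.
  have := Emin _ constant_admissible.
  by rewrite Ec_constant// (Ec_density h0 c0' dm mp) lee_fin (int_lagr hh dm mp).
have b10 : b1 <= b0 by rewrite -(ler_pM2l c0); lra.
have a1r : a1 <= 2 * h * r.
  by apply: le_trans le3; rewrite lerDl mulr_ge0.
have zh : 0 \in `[- h, h] by rewrite in_itv/= oppr_le0 ltW.
(* The best weight is sqrt (2 h r / b1), about 1.49 r in the extreme case h = 72/125 r and b1 =
   81/156. *)
have s0 : 0 <= 3 / 2 * r by rewrite mulr_ge0// ltW.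
have := energy_descent dm mp _ (ext_h c0' m0 mr Tm) zh (extremal0 c0' m0) s0.
rewrite -/a1 -/b1 extremal_even// => /(_ (ext_h c0' m0 mr Tm)) key.
have b1u : b1 <= 81 / 156 := le_trans b10 bend_soap.
have h1 : 6 * r * (r - m) <= r * (2 * h + 9 / 4 * r * (81 / 156)).
  rewrite (_ : 6 * r * (r - m) = 4 * (3 / 2 * r) * (r - m)); last by field.
  apply: (le_trans key); rewrite exprMn.
  have : r ^+ 2 * b1 <= r ^+ 2 * (81 / 156) by rewrite ler_pM2l// exprn_gt0.
  by move: a1r; lra.
have : r * (6 * (r - m)) <= r * (2 * h + 9 / 4 * r * (81 / 156)) by move: h1; lra.
rewrite ler_pM2l// => h2.
by move: h2 hr_ub r0; lra.
Qed.

(** For c > 0 the first integral is strict, so [catenary_compare] with k = m on [[0, h]] gives r / m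
    < cosh (h / m), that is, phi (h / m) < phi t0. As h / m <= 1, monotonicity yields h / m < t0. *)
Lemma minimum_gt_soap (m : R) : 0 < m -> m <= r -> tau c m r = h ->
  h < m -> k < m.
Proof.
move=> m0 mr Tm hm; have c0' := ltW c0.
have cext := der_cont (der_extremal c0' m0).
have cmp := @catenary_compare R m (Z c m) 0 h (ext c m) m0 h0.
have := cmp (continuous_subspaceT _) (fun x _ => ext_ge c0' m0 x) _.
rewrite subr0 (ext_h c0' m0 mr Tm) extremal0// divff ?gt_eqF// => /(_ cext) H.
have a1 : arcosh (1 : R) = 0 by rewrite -(@coshR0 R) arcosh_coshR.
rewrite a1 subr0 in H.
have Z0p x : 0 < x -> 0 < Z c m x by move=> x0; rewrite -(slope_at0 c0' m0); exact: slope_at_lt.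
have {}H : arcosh (r / m) < h / m.
  apply: H => x /andP[x0 xh]; split; [exact: der_extremal|exact/ltW/Z0p|].
  have zp := Z0p x x0; have y0 := height_gt0 c0' m0 (Z c m x); have s0 := slope_norm_gt0 (Z c m x).
  rewrite /extremal {1}(first_integral c0' m0 (Z c m x)); set y := Y _ _ _ in y0 *; set s := S _ in s0 *.
  have -> : (y / s - c * Z c m x ^+ 2 / (y * s ^+ 3)) * s = y - c * Z c m x ^+ 2 / (y * s ^+ 2).
    by field; rewrite !gt_eqF.
  by rewrite gtrBl; apply: divr_gt0; apply: mulr_gt0 => //; exact: exprn_gt0.
have hm0 : 0 <= h / m by rewrite divr_ge0 ?ltW.
have hm1 : h / m <= 1 by rewrite ler_pdivrMr// mul1r ltW.
have rch : r / m < ch (h / m).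
  rewrite ltNge; apply/negP => /(arcosh_le (coshR_ge1 _)); rewrite arcosh_coshR//.
  by rewrite leNgt H.
have : phi (h / m) < phi t0.
  rewrite et /phi ltr_pdivrMr ?coshR_gt0//.
  have -> : h / m = h / r * (r / m) by field; rewrite !gt_eqF.
  by rewrite ltr_pM2l ?divr_gt0// -(_ : h / m = h / r * (r / m))//; field; rewrite !gt_eqF.
move=> ph; rewrite /k ltr_pdivrMr// mulrC -ltr_pdivrMr// ltNge.
apply/negP => tm; move: ph; rewrite ltNge => /negP; apply.
exact: (phi_le (ltW t00) tm hm1).
Qed.

(** Both curves have height r at h. The extremal has m > k, hence climbs more slowly than the
    catenary of parameter k, so going back from h it stays above it. *)
Lemma extremal_gt_soap (m : R) : 0 < m -> m <= r -> tau c m r = h -> k < m ->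
  forall x : R, 0 <= x < h -> k * ch (x / k) < ext c m x.
Proof.
move=> m0 mr Tm km x /andP[x0 xh]; have c0' := ltW c0.
have cext := der_cont (der_extremal c0' m0).
have ke y : k <= ext c m y by apply: le_trans (ltW km) (ext_ge c0' m0 y).
have H : arcosh (ext c m h / k) - arcosh (ext c m x / k) < (h - x) / k.
  apply: (@catenary_compare R k (Z c m) x h (ext c m) k0 xh) => //.
    exact: continuous_subspaceT.
  move=> y /andP[xy yh]; have y0 := le_trans x0 (ltW xy).
  split; [exact: der_extremal|exact: slope_at_ge0|].
  have s0 := slope_norm_gt0 (Z c m y).
  apply: (@lt_le_trans _ _ (m * S (Z c m y))); first by rewrite ltr_pM2r.
  exact: height_ge.
have rk : r / k = ch t0.
  have := et; rewrite /phi /k => e; have c1 := coshR_gt0 t0.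
  have -> : h = t0 / ch t0 * r by rewrite e divfK// gt_eqF.
  by field; rewrite !gt_eqF.
rewrite (ext_h c0' m0 mr Tm) rk arcosh_coshR ?(ltW t00)// in H.
have hk : h / k = t0 by rewrite /k; field; rewrite !gt_eqF.
have xk : x / k < arcosh (ext c m x / k).
  by move: H; rewrite mulrBl hk; lra.
have xk0 : 0 <= x / k by rewrite divr_ge0// ltW.
rewrite mulrC -ltr_pdivlMr// ltNge; apply/negP => le.
have ek1 : 1 <= ext c m x / k by rewrite ler_pdivlMr// mul1r.
have := arcosh_le ek1 le; rewrite arcosh_coshR//.
by rewrite leNgt xk.
Qed.

End Comparison.
End Fixed.
End Consequences.

(** * The theorem *)

Section Main.
Variable R : realType.
Local Notation Z := (@slope_at R).
Local Notation ext := (@extremal R).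
Local Notation tau := (@time R).
Variables (h r : R) (h0 : 0 < h) (r0 : 0 < r) (hr : h / r <= omega R).

Lemma Phi_minimal_exists (c : R) : 0 <= c -> exists m, Phi_minimal h r c m.
Proof.
rewrite le_eqVlt => /predU1P[<-|cp]; last first.
  by have [m mr mmin] := Phi_min (ltW cp) h0 cp r0; exists m.
have [t0 [/andP[t00 t02] et ct]] := catenary_parameter h0 r0 hr.
by exists (h / t0); exact: Phi_minimal_soap.
Qed.

Lemma minimizer_form (c : R) (rho : R -> R) : 0 <= c -> minimizer h r c rho ->
  exists m, [/\ 0 < m, m <= r, tau c m r = h, minimizer h r c (ext c m) &
    forall x, x \in `[- h, h] -> rho x = ext c m x].
Proof.
move=> c0 mrho; have [m1 m1min] := Phi_minimal_exists c0.
have [m [mmin Tm rE]] := minimizer_extremal h0 c0 m1min mrho.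
have [/andP[m0 mr] _] := mmin.
have mm := Phi_minimal_minimizer h0 c0 mmin.
by exists m; split; [exact: m0|exact: mr|exact: Tm|exact: mm|exact: rE].
Qed.

Lemma extremal_lt_r (c m x : R) : 0 <= c -> 0 < m -> m <= r -> tau c m r = h ->
  - h < x < h -> ext c m x < r.
Proof.
move=> c0 m0 mr Tm.
have lt y : 0 <= y -> y < h -> ext c m y < r.
  move=> y0 yh; rewrite -(ext_h c0 m0 mr Tm) /extremal.
  by apply: height_lt => //; [exact: slope_at_ge0|exact: slope_at_lt].
move=> /andP[hx xh]; have [x0|/ltW x0] := leP 0 x; first exact: lt.
by rewrite -extremal_even//; apply: lt; rewrite ?oppr_ge0// ltrNl.
Qed.

Lemma extremal_le_r (c m x : R) : 0 <= c -> 0 < m -> m <= r -> tau c m r = h ->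
  x \in `[- h, h] -> ext c m x <= r.
Proof.
move=> c0 m0 mr Tm; rewrite in_itv/= => /andP[].
rewrite le_eqVlt => /predU1P[<- _|hx]; first by rewrite extremal_even// (ext_h c0 m0 mr Tm).
rewrite le_eqVlt => /predU1P[->|xh]; first by rewrite (ext_h c0 m0 mr Tm).
by apply: ltW; apply: extremal_lt_r; rewrite ?hx.
Qed.

Lemma minimizer_gt_soap (c m x : R) : 0 < c -> 0 < m -> m <= r -> tau c m r = h ->
  minimizer h r c (ext c m) -> - h < x < h -> rho0 h r x < ext c m x.
Proof.
move=> cp m0 mr Tm mmin.
have [t0 [/andP[t00 t02] et ct]] := catenary_parameter h0 r0 hr.
have t01 : t0 <= 1 by apply: (le_trans t02); apply: (le_trans (ln2_ub R)); lra.
rewrite /rho0 (Pi0E h0 r0 t00 t01 et).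
have hm := minimum_gt_h h0 r0 t00 t02 et ct cp m0 mr Tm mmin.
have km := minimum_gt_soap h0 r0 t00 et cp m0 mr Tm hm.
have gt y : 0 <= y -> y < h -> h / t0 * coshR (y / (h / t0)) < ext c m y.
  by move=> y0 yh; apply: (extremal_gt_soap h0 r0 t00 et cp m0 mr Tm km); rewrite y0.
move=> /andP[hx xh]; have [x0|/ltW x0] := leP 0 x; first exact: gt.
by rewrite -(extremal_even (ltW cp) m0) -(coshRN (x / _)) -mulNr; apply: gt; rewrite ?oppr_ge0// ltrNl.
Qed.

Lemma extremal_C2 (c m : R) (rho : R -> R) : 0 <= c -> 0 < m ->
  (forall x, x \in `[- h, h] -> rho x = ext c m x) ->
  C2_on h rho (Z c m) (fun x => (speed c m (Z c m x))^-1).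
Proof.
move=> c0 m0 rE; have [_ _ cZ _ dZ] := slope_atP c0 m0; split.
  apply: continuous_subspaceT => x.
  have v0 := speed_gt0 c0 m0 (Z c m x).
  apply: (@continuousV _ _ (fun x => speed c m (Z c m x))); first by rewrite gt_eqF.
  by apply: (@continuous_comp _ _ _ (Z c m) (speed c m)); [exact: cZ|exact: speed_continuous].
move=> x xh; split.
  by apply: (derive_has_deriv_within xh rE); exact: der_extremal.
by apply: (derive_has_deriv_within (f' := Z c m) xh) => //; exact: dZ.
Qed.

Lemma minimum_near_r (c m : R) : 0 < c -> 0 < m -> m <= r -> tau c m r = h ->
  minimizer h r c (ext c m) -> 2 * Num.sqrt c * (r - m) <= h * r.
Proof.
move=> cp m0 mr Tm [_ mmin]; have c0 := ltW cp.
have mp x : x \in `[- h, h] -> 0 < ext c m x by move=> _; exact: height_gt0.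
have dm := ext_density h c0 m0.
have zh : 0 \in `[- h, h] by rewrite in_itv/= oppr_le0 ltW.
have hh : - h <= h by rewrite ge0_cp// ltW.
(* The weight sqrt c turns the right-hand side into E_c itself. *)
have := energy_descent h0 dm mp _ (ext_h c0 m0 mr Tm) zh (extremal0 c0 m0) (sqrtr_ge0 c).
rewrite extremal_even// => /(_ (ext_h c0 m0 mr Tm)).
have := mmin _ (constant_admissible h r0); rewrite (Ec_constant h0 r0 c0) (Ec_density h0 c0 dm mp) lee_fin.
rewrite (int_lagr hh dm mp) sqr_sqrtr// => le1 le2.
by have := le_trans le2 le1; move: (Num.sqrt c) => s; lra.
Qed.

End Main.

Theorem theorem1p1 (R : realType) (h r : R) :
  0 < h -> 0 < r -> h / r <= omega R ->
  (forall c : R, 0 <= c -> exists rho, minimizer h r c rho) /\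
  (forall (c : R) (rho : R -> R), 0 <= c -> minimizer h r c rho ->
     (* (a) *) (forall x, x \in `[-h, h] -> rho (- x) = rho x) /\
     (* (b) *) strictly_convex_on h rho /\
     (* (c) *) (0 < c -> forall x, x \in `]-h, h[ -> rho0 h r x < rho x < r) /\
     (* (e) *) (exists d1 d2 : R -> R, C2_on h rho d1 d2 /\
        (forall x, x \in `[-h, h] ->
           (1 + d1 x ^+ 2) * ((c + rho x ^+ 2) * d1 x ^+ 2 + rho x ^+ 2)
           = rho x * d2 x * (rho x ^+ 2 * d1 x ^+ 2 + c * (2 - d1 x ^+ 2)
                              + rho x ^+ 2)) /\
        (forall x, x \in `[-h, h] ->
           c * (d1 x ^+ 2 / (rho x * (Num.sqrt (1 + d1 x ^+ 2)) ^+ 3))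
           - rho x / Num.sqrt (1 + d1 x ^+ 2) = - rho 0))) /\
  (* (d) *)
  (forall (cs : nat -> R) (rhos : nat -> R -> R),
     cs @ \oo --> +oo ->
     (forall j, 0 <= cs j /\ minimizer h r (cs j) (rhos j)) ->
     forall eps : R, 0 < eps ->
       \forall j \near \oo, forall x, x \in `[-h, h] -> `|rhos j x - r| < eps).
Proof.
move=> h0 r0 hr; split; [|split].
- move=> c c0; have [m mmin] := Phi_minimal_exists h0 r0 hr c0.
  by exists (extremal c m); exact: Phi_minimal_minimizer.
- move=> c rho c0 /(minimizer_form h0 r0 hr c0) [m [m0 mr Tm mmin rE]].
  have NE x : x \in `[- h, h] -> - x \in `[- h, h].
    by rewrite !in_itv/= lerN2 lerNl andbC.
  split; [|split; [|split]].
  + by move=> x xh; rewrite !rE ?NE// extremal_even.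
  + have [_ _ _ ltZ _] := slope_atP c0 m0.
    have sc := strictly_convex_derive (h := h) (der_extremal c0 m0) ltZ.
    move=> x y t xh yh xy t01; rewrite !rE//; first exact: sc.
    move: xh yh t01; rewrite !in_itv/= => /andP[? ?] /andP[? ?] /andP[? ?].
    by apply/andP; split; nra.
  + move=> cp x xh; have xh' : x \in `[- h, h] by exact: subset_itv_oo_cc.
    move: xh; rewrite in_itv/= => xh; rewrite rE//.
    by rewrite (minimizer_gt_soap h0 r0 hr cp m0 mr Tm mmin xh) (extremal_lt_r c0 m0 mr Tm xh).
  + exists (slope_at c m), (fun x => (speed c m (slope_at c m x))^-1).
    (* The second derivative is 1 / V, so multiplying by V reduces the equation to [speed_EL]. *)
    split; [exact: extremal_C2|split => x xh].
      rewrite rE// /extremal; set p := slope_at c m x.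
      have v0 := speed_gt0 c0 m0 p; have e := speed_EL c0 m0 p.
      have vn : speed c m p != 0 by rewrite gt_eqF.
      apply: (mulfI vn); rewrite e; move: (speed c m p) vn => v vn.
      by field.
    have zh : 0 \in `[- h, h] by rewrite in_itv/= oppr_le0 ltW.
    rewrite !rE// extremal0// /extremal; set p := slope_at c m x.
    by rewrite [in RHS](first_integral c0 m0 p) /slope_norm opprB mulrA.
(* This k satisfies 2 k eps = h r + 2 eps > h r, so once sqrt c > k, [minimum_near_r] rules out r -
   m >= eps. *)
- move=> cs rhos csy Hm eps eps0; pose k := h * r / (2 * eps) + 1.
  have k0 : 0 < k by rewrite addr_gt0 ?divr_gt0 ?mulr_gt0.
  move/cvgryPgt : csy => /(_ (k ^+ 2)); apply: filterS => j kc x xh.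
  have [c0 /(minimizer_form h0 r0 hr c0) [m [m0 mr Tm mmin rE]]] := Hm j.
  have cp : 0 < cs j by apply: lt_trans kc; rewrite exprn_gt0.
  have near_r := minimum_near_r h0 r0 cp m0 mr Tm mmin.
  have ks : k < Num.sqrt (cs j) by rewrite -(gtr0_norm k0) -sqrtr_sqr ltr_sqrt.
  have le_r : extremal (cs j) m x <= r by exact: (extremal_le_r c0 m0 mr Tm xh).
  rewrite rE// distrC ger0_norm; last by rewrite subr_ge0.
  apply: (@le_lt_trans _ _ (r - m)); first by rewrite lerD2l lerN2; exact: ext_ge.
  rewrite ltNge; apply/negP => re.
  have : 2 * k * eps <= h * r.
    apply: le_trans near_r; apply: ler_pM => //; [by rewrite mulr_ge0// ltW|exact: ltW|].
    by rewrite ler_pM2l// ltW.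
  have -> : 2 * k * eps = h * r + 2 * eps by rewrite /k; field; rewrite gt_eqF.
  by rewrite gerDl leNgt mulr_gt0.
Qed.
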